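(* Let $k$ be a positive integer and $N\ge 4k-1$. Then there exist $k$ positive constants $D_{k,0}^i$ ($i=1,\dots,k$) such that $$\int_{\mathbb{H}^N}|\nabla_r^k u|^2\,dv_{\mathbb{H}^N}-\Big(\frac{N-1}{2}\Big)^{2k}\int_{\mathbb{H}^N}u^2\,dv_{\mathbb{H}^N}\ \ge\ \sum_{i=1}^{k}D_{k,0}^i\int_{\mathbb{H}^N}\frac{u^2}{r^{2i}}\,dv_{\mathbb{H}^N}$$ for all $u\in C_c^\infty(\mathbb{H}^N\setminus\{o\})$. Moreover, the leading constants are given by $$D_{k,0}^k=\begin{cases}\Big(\dfrac{N-4}{2^{2m}}\Big)^2\displaystyle\prod_{j=1}^{m-1}(N+4j)^2(N-4j-4)^2 & \text{if } k=2m,\\[2mm] \dfrac{1}{2^{4m+2}}\displaystyle\prod_{j=1}^{m}(N+4j-2)^2(N-4j-2)^2 & \text{if } k=2m+1,\end{cases}$$ and $$D_{k,0}^1=\begin{cases}\dfrac{N^2-1}{16}\displaystyle\sum_{j=1}^{m}\Big(\frac{N-1}{2}\Big)^{4m-2j-2} & \text{if } k=2m,\\[2mm] (N^2-1)\displaystyle\sum_{j=1}^{m}\frac{(N-1)^{2m+2j-2}}{2^{2m+2j+2}}+\frac{(N-1)^{2m}}{2^{2m+2}} & \text{if } k=2m+1.\end{cases}$$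
   Context: $\mathbb{H}^N$ is the $N$-dimensional hyperbolic space with a fixed pole $o$. In geodesic polar coordinates $x=(r,\sigma)\in(0,\infty)\times\mathbb{S}^{N-1}$ about $o$, with $r$ the geodesic distance from $x$ to $o$, the metric is $dr^2+\sinh^2 r\,d\omega^2$ and $dv_{\mathbb{H}^N}=(\sinh r)^{N-1}\,dr\,d\sigma$ is the volume element. The radial gradient and radial Laplacian are $$\nabla_r u=\Big(\frac{\partial u}{\partial r},0\Big),\quad |\nabla_r u|^2=\Big(\frac{\partial u}{\partial r}\Big)^2,\qquad \Delta_r u=\frac{\partial^2u}{\partial r^2}+(N-1)\coth r\,\frac{\partial u}{\partial r}.$$ For a non-negative integer $k$, $\nabla_r^k u=\Delta_r^{k/2}u$ if $k$ is even and $\nabla_r^k u=\nabla_r\Delta_r^{(k-1)/2}u$ if $k$ is odd, where $\Delta_r^j$ is the $j$-th iterate of $\Delta_r$. Empty sums are $0$ and empty products are $1$. The constants depend only on $N$, $k$ and $i$, not on $u$. *)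

(* Defs.v *)
From HB Require Import structures.
From mathcomp Require Import all_boot all_order all_algebra.
From mathcomp Require Import all_classical all_reals all_analysis.
From mathcomp Require Import measurable_realfun.

Set Implicit Arguments.
Unset Strict Implicit.
Unset Printing Implicit Defensive.

Import Order.TTheory GRing.Theory Num.Theory.
Import numFieldNormedType.Exports.

Local Open Scope classical_set_scope.
Local Open Scope ring_scope.

(* Hyperbolic space H^N is described in geodesic normal coordinates at the pole
   o: the point with geodesic polar coordinates (r, s) is represented by the
   vector r *: s of R^N (the inverse of the exponential map at o), so that o is
   the vector 0, the geodesic distance to o is the Euclidean length (enorm),
   and H^N \ {o} is R^N \ {0}, with metric dr^2 + sinh^2 r dw^2 and volume
   element (sinh r)^(N-1) dr ds. *)

Section hyperbolic_functions.
Context {R : realType}.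

Definition sinh (x : R) : R := (expR x - expR (- x)) / 2.
Definition cosh (x : R) : R := (expR x + expR (- x)) / 2.
Definition coth (x : R) : R := cosh x / sinh x.

End hyperbolic_functions.

Section euclidean.
Context {R : realType} {N : nat}.

(* The library norm on 'rV[R]_N is the sup norm. *)
Definition enorm (x : 'rV[R]_N) : R := Num.sqrt (\sum_(i < N) x 0 i ^+ 2).

(* The angular coordinate of a nonzero vector. *)
Definition angle (x : 'rV[R]_N) : 'rV[R]_N := (enorm x)^-1 *: x.

End euclidean.

Section lebesgue_cons.
Context {R : realType} {n : nat}.
Variable m : {sigma_finite_measure set (n.-tuple R) -> \bar R}.

Definition tuple_cons (p : R * n.-tuple R) : n.+1.-tuple R :=
  [tuple of p.1 :: p.2].

Definition tuple_uncons (t : n.+1.-tuple R) : R * n.-tuple R :=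
  (thead t, [tuple of behead t]).

Lemma measurable_tuple_cons : measurable_fun [set: R * n.-tuple R] tuple_cons.
Proof. exact: measurable_cons. Qed.

Lemma measurable_tuple_uncons : measurable_fun [set: n.+1.-tuple R] tuple_uncons.
Proof.
apply: measurable_fun_pair; first exact: measurable_tnth.
exact: measurable_behead.
Qed.

Lemma tuple_consK : cancel tuple_cons tuple_uncons.
Proof. by case=> x t; congr pair; apply/val_inj. Qed.

Lemma tuple_unconsK : cancel tuple_uncons tuple_cons.
Proof. by move=> t; rewrite [RHS](tuple_eta t). Qed.

(* The product of Lebesgue measure on the first coordinate and m on the
   remaining ones. *)
Definition lebesgue_cons : set (n.+1.-tuple R) -> \bar R :=
  pushforward (lebesgue_measure \x m)%E tuple_cons.

Let lebesgue_cons0 : lebesgue_cons set0 = 0%E.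
Proof. by rewrite /lebesgue_cons /pushforward preimage_set0 measure0. Qed.

Let lebesgue_cons_ge0 A : (0 <= lebesgue_cons A)%E.
Proof. by rewrite /lebesgue_cons /pushforward; exact: measure_ge0. Qed.

Let measurable_preimage_cons A :
  measurable A -> measurable (tuple_cons @^-1` A).
Proof.
by move=> mA; rewrite -[X in measurable X]setTI; exact: measurable_tuple_cons.
Qed.

Let lebesgue_cons_sigma_additive : semi_sigma_additive lebesgue_cons.
Proof.
move=> F mF tF mUF; rewrite /lebesgue_cons /pushforward preimage_bigcup.
apply: measure_semi_sigma_additive.
- by move=> i; exact: measurable_preimage_cons.
- apply/trivIsetP => /= i j _ _ ij; rewrite -preimage_setI.
  by move/trivIsetP : tF => /(_ _ _ _ _ ij) ->//; rewrite preimage_set0.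
- by rewrite -preimage_bigcup; exact: measurable_preimage_cons.
Qed.

HB.instance Definition _ := isMeasure.Build _ _ _ lebesgue_cons
  lebesgue_cons0 lebesgue_cons_ge0 lebesgue_cons_sigma_additive.

Let lebesgue_cons_sigma_finite : sigma_finite setT lebesgue_cons.
Proof.
have /sigma_finiteP[F [TF ndF Foo]] := sigma_finiteT (@lebesgue_measure R).
have /sigma_finiteP[G [TG ndG Goo]] := sigma_finiteT m.
exists (fun i => tuple_uncons @^-1` (F i `*` G i)).
  apply/seteqP; split => // t _.
  have [/= i _ Fi] : (\bigcup_i F i) (thead t) by rewrite -TF.
  have [/= j _ Gj] : (\bigcup_i G i) [tuple of behead t] by rewrite -TG.
  exists (maxn i j) => //; split => /=.
  - by move: Fi; exact/subsetPset/ndF/leq_maxl.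
  - by move: Gj; exact/subsetPset/ndG/leq_maxr.
move=> i; have [mF Fi] := Foo i; have [mG Gi] := Goo i; split.
  rewrite -[X in measurable X]setTI; apply: measurable_tuple_uncons => //.
  exact: measurableX.
rewrite /lebesgue_cons /pushforward -comp_preimage.
rewrite (_ : tuple_uncons \o tuple_cons = id) ?preimage_id; last first.
  by apply/funext => p /=; rewrite tuple_consK.
by rewrite product_measure1E// lte_mul_pinfty// ge0_fin_numE.
Qed.

HB.instance Definition _ := Measure_isSigmaFinite.Build _ _ _ lebesgue_cons
  lebesgue_cons_sigma_finite.

End lebesgue_cons.

Section sphere.
Context {R : realType}.

(* Lebesgue measure on R^n, where R^n carries the library's product
   sigma-algebra on tuples. *)
Fixpoint lebesgue_tuple n : {sigma_finite_measure set (n.-tuple R) -> \bar R} :=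
  if n is n'.+1 then lebesgue_cons (lebesgue_tuple n') else \d_ [tuple].

Definition tuple_row n (t : n.-tuple R) : 'rV[R]_n := \row_i tnth t i.

Definition row_tuple n (x : 'rV[R]_n) : n.-tuple R := [tuple x 0 i | i < n].

Definition unit_sphere n : set (n.-tuple R) :=
  [set s | enorm (tuple_row s) = 1].

Definition tuple_angle n (t : n.-tuple R) : n.-tuple R :=
  row_tuple (angle (tuple_row t)).

Definition punctured_ball n : set (n.-tuple R) :=
  [set t | 0 < enorm (tuple_row t) <= 1].

Lemma measurable_enorm n :
  measurable_fun [set: n.-tuple R] (fun t => enorm (tuple_row t)).
Proof.
apply: (@measurableT_comp _ _ _ _ _ _ (@Num.sqrt R)).
  by apply: continuous_measurable_fun; exact: sqrt_continuous.
apply: measurable_sum => i; apply: measurable_funX.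
under eq_fun do rewrite mxE; exact: measurable_tnth.
Qed.

Lemma measurable_tuple_angle n : measurable_fun [set: n.-tuple R] (@tuple_angle n).
Proof.
apply/measurable_fun_tnthP => i /=.
have -> : tnth (T:=R) ^~ i \o @tuple_angle n =
    (fun t => enorm (tuple_row t) `^ (-1) * tnth t i).
  by apply/funext => t /=; rewrite tnth_mktuple !mxE powR_inv1 // sqrtr_ge0.
apply: measurable_funM; last exact: measurable_tnth.
apply: (@measurableT_comp _ _ _ _ _ _ (@powR R ^~ (-1))).
  exact: measurable_powR.
exact: measurable_enorm.
Qed.

Lemma measurable_punctured_ball n : measurable (@punctured_ball n).
Proof.
rewrite (_ : @punctured_ball n =
  setT `&` (fun t : n.-tuple R => enorm (tuple_row t)) @^-1` `]0, 1]).
  exact: (measurable_enorm measurableT).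
by rewrite setTI; apply/seteqP; split => t /=; rewrite in_itv.
Qed.

(* The surface measure ds on the unit sphere: n times the Lebesgue measure of
   the cone over A, i.e. of the vectors t s with 0 < t <= 1 and s in A. *)
Definition sphere_measure n (A : set (n.-tuple R)) : \bar R :=
  (n%:R%:E * lebesgue_tuple n (@tuple_angle n @^-1` A `&` @punctured_ball n))%E.

End sphere.

Section sphere_measure_instance.
Context {R : realType} {n : nat}.

Let cone_measure : {measure set (n.-tuple R) -> \bar R} :=
  mscale (n%:R%:nng : {nonneg R})
    (mrestr (lebesgue_tuple n) (@measurable_punctured_ball R n)).

Let sphere_measureE A :
  sphere_measure A = cone_measure (@tuple_angle R n @^-1` A).
Proof. by []. Qed.

Let measurable_preimage_angle (A : set (n.-tuple R)) :
  measurable A -> measurable (@tuple_angle R n @^-1` A).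
Proof.
by move=> mA; rewrite -[X in measurable X]setTI; exact: measurable_tuple_angle.
Qed.

Let sphere_measure0 : sphere_measure (set0 : set (n.-tuple R)) = 0%E.
Proof. by rewrite sphere_measureE preimage_set0 measure0. Qed.

Let sphere_measure_ge0 (A : set (n.-tuple R)) : (0 <= sphere_measure A)%E.
Proof. by rewrite sphere_measureE; exact: measure_ge0. Qed.

Let sphere_measure_sigma_additive :
  semi_sigma_additive (@sphere_measure R n).
Proof.
move=> F mF tF mUF; rewrite sphere_measureE preimage_bigcup.
apply: measure_semi_sigma_additive.
- by move=> i; exact: measurable_preimage_angle.
- apply/trivIsetP => /= i j _ _ ij; rewrite -preimage_setI.
  by move/trivIsetP : tF => /(_ _ _ _ _ ij) ->//; rewrite preimage_set0.
- by rewrite -preimage_bigcup; exact: measurable_preimage_angle.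
Qed.

HB.instance Definition _ := isMeasure.Build _ _ _ (@sphere_measure R n)
  sphere_measure0 sphere_measure_ge0 sphere_measure_sigma_additive.

Let box m : set (m.-tuple R) := [set t | forall i, tnth t i \in `[-1, 1]].

Let box_lty m : measurable (@box m) /\ (lebesgue_tuple m (@box m) < +oo)%E.
Proof.
elim: m => [|m [mbox IH]].
  rewrite (_ : @box 0 = setT); last by apply/seteqP; split => // t _ [].
  by split => //=; rewrite diracT ltry.
have boxE : tuple_cons @^-1` @box m.+1 = `[-1, 1] `*` @box m.
  apply/seteqP; split=> [[x t] /= xt|[x t] /= [x1 t1] i].
    split; first by have := xt ord0; rewrite (tnth_nth 0).
    by move=> i; have := xt (lift ord0 i); rewrite tnthS.
  case: (unliftP ord0 i) => [j|] ->; first by rewrite tnthS; exact: t1.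
  by rewrite (tnth_nth 0).
have mb1 : measurable (`[-1, 1]%classic : set R) by [].
split.
  rewrite (_ : @box m.+1 = setT `&` tuple_uncons @^-1` (`[-1, 1] `*` @box m)).
    by apply: measurable_tuple_uncons => //; exact: measurableX.
  rewrite setTI -boxE -comp_preimage.
  rewrite (_ : tuple_cons \o tuple_uncons = id) ?preimage_id//.
  by apply/funext => t /=; rewrite tuple_unconsK.
rewrite /= /lebesgue_cons /pushforward boxE product_measure1E//.
rewrite lte_mul_pinfty//.
by rewrite [X in X \is a fin_num]lebesgue_measure_itv /=; case: ifP.
Qed.

Let sphere_measure_fin : fin_num_fun (@sphere_measure R n).
Proof.
move=> A mA; rewrite ge0_fin_numE ?measure_ge0// lte_mul_pinfty//.
have [mbox] := box_lty n; apply: le_lt_trans; apply: le_measure.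
- by rewrite inE; apply: measurableI;
    [exact: measurable_preimage_angle|exact: measurable_punctured_ball].
- by rewrite inE.
move=> t [_ /andP[_ t1]] i; rewrite in_itv/= -ler_norml.
apply: le_trans t1; rewrite -sqrtr_sqr ler_sqrt; last first.
  by apply: sumr_ge0 => j _; exact: sqr_ge0.
rewrite (bigD1 i)//= mxE lerDl; apply: sumr_ge0 => j _; exact: sqr_ge0.
Qed.

HB.instance Definition _ := Measure_isFinite.Build _ _ _ (@sphere_measure R n)
  sphere_measure_fin.

End sphere_measure_instance.

Section hyperbolic_space.
Context {R : realType} {N : nat}.
Implicit Types u f : 'rV[R]_N -> R.

Definition hyp_integral f : \bar R :=
  (\int[lebesgue_measure \x @sphere_measure R N]_(p in `]0%R, +oo[ `*` @unit_sphere R N)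
     (f (p.1 *: tuple_row p.2) * sinh p.1 ^+ N.-1)%:E)%E.

(* d/dr: differentiation along the unit vector x / |x|, which is constant on
   the ray through x. *)
Definition radial_derive u : 'rV[R]_N -> R := fun x => 'D_(angle x) u x.

Definition radial_laplacian u : 'rV[R]_N -> R := fun x =>
  radial_derive (radial_derive u) x
    + (N%:R - 1) * coth (enorm x) * radial_derive u x.

(* |nabla_r^k u|^2, using |nabla_r v|^2 = (dv/dr)^2. *)
Definition radial_grad_sq k u : 'rV[R]_N -> R := fun x =>
  let v := iter k./2 radial_laplacian u in
  (if odd k then radial_derive v x else v x) ^+ 2.

Definition iter_partial (s : seq 'I_N) u : 'rV[R]_N -> R :=
  foldr (fun i g x => 'D_(delta_mx 0 i) g x) u s.

Definition smooth_on (U : set 'rV[R]_N) u : Prop :=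
  forall (s : seq 'I_N) x, U x ->
    {for x, continuous (iter_partial s u)} /\
    forall i : 'I_N, derivable (iter_partial s u) x (delta_mx 0 i).

Definition punctured : set 'rV[R]_N := [set x | x != 0].

Definition Cc_infty_punctured u : Prop :=
  [/\ smooth_on punctured u,
      compact (closure [set x | u x != 0]) &
      closure [set x | u x != 0] `<=` punctured].

End hyperbolic_space.

(* Main.v *)
Require Import Defs.
From HB Require Import structures.
From mathcomp Require Import all_boot all_order all_algebra.
From mathcomp Require Import all_classical all_reals all_analysis.
From mathcomp Require Import measurable_realfun.
From mathcomp Require Import ring lra zify.

(** Write n = N - 1, lam = (n / 2)^2, c = n (n - 2) / 4, K = coth and
    w = sinh^n. In polar coordinates each integral of the theorem is an integral
    over the unit sphere of integrals along rays. Along the ray of direction s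
    the function f(r) = u(r s) is smooth with compact support in (0, oo), and
    the radial Laplacian acts as L f = f'' + n K f'. So it is enough to prove,
    with constants that do not depend on f, a one-dimensional inequality for L
    with the weight w ([radial_inequality]), and to integrate it over the sphere
    by Tonelli's theorem ([le_shell_integral], [hyp_integral_improvement]).

    On the half-line everything comes from the weighted Hardy inequality
    [weighted_hardy]
      int x^-k V_k f^2 w <= - int x^-k f (L f) w,
      V_k = (1 - k^2) / (4 x^2) + lam + c (K^2 - 1),
    whose two sides differ by a perfect square and an exact derivative.
    Expanding (L f + (a + s / x^2) f)^2 >= 0 turns it into a family of Rellich
    inequalities with two free parameters a, s >= 0 ([weighted_rellich]). Using
    K^2 - 1 = 1 / sinh^2 >= 0 and K^2 - 1 >= 1 / x^2 - 1, three choices are made: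
    - a = lam, s = 0 bounds int (L f)^2 w below by lam^2 int f^2 w with the gain
      (lam / 2) int x^-2 f^2 w ([poincare_hardy_rellich]);
    - a = lam, s = 1/8 keeps lam^2 and produces the x^-2 and x^-4 terms of the
      case k = 2 ([poincare_rellich]);
    - a = 0 and s = (N + k) (N - k - 4) / 4 gives the Euclidean Rellich constant
      from x^-k to x^(-k-4), plus a positive x^(-k-2) term ([rellich_step]); it
      can be iterated ([rellich_chain]).
    For k = 2m the second choice is applied to L^(m-1) f; its lam^2 term is
    bounded by iterating the first choice, its x^-4 term by iterating the third,
    which yields exactly the constant announced for x^(-2k). For k = 2m + 1 one
    starts instead from the first-order inequality [poincare_hardy].

    When k >= 3 the coefficient lam^(k-1) / 2 obtained for x^-2 is strictly larger
    than the announced one, which is governed by a geometric sum of ratio lam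
    ([first_even_lt], [first_odd_lt]), and the chain leaves a positive multiple
    of x^(-2(k-1)). Since x^(-2i) <= x^-2 + x^(-2(k-1)) for 1 <= i < k, these two
    excesses pay for small positive constants in the intermediate range
    ([spread_constants]). *)

Set Implicit Arguments.
Unset Strict Implicit.
Unset Printing Implicit Defensive.

Import Order.TTheory GRing.Theory Num.Theory.
Import numFieldNormedType.Exports.

Local Open Scope classical_set_scope.
Local Open Scope ring_scope.

Local Notation "f ^`()" := (derive1 f) : ring_scope.

(** * Calculus on the open half-line *)

Section smooth.
Context {R : realType}.
Implicit Types (f g : R -> R) (x a b : R).

Lemma is_derive1M f g x a b : is_derive x 1 f a -> is_derive x 1 g b ->
  is_derive x 1 (fun y => f y * g y) (a * g x + f x * b).
Proof.
move=> fa gb; apply: (@is_derive_eq _ _ _ (f * g)).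
by rewrite /GRing.scale /= addrC mulrC.
Qed.

Lemma is_derive1D f g x a b : is_derive x 1 f a -> is_derive x 1 g b ->
  is_derive x 1 (fun y => f y + g y) (a + b).
Proof. by move=> fa gb; exact: (@is_deriveD _ _ _ f g). Qed.

Lemma is_derive1N f x a : is_derive x 1 f a ->
  is_derive x 1 (fun y => - f y) (- a).
Proof. by move=> fa; exact: (@is_deriveN _ _ _ f). Qed.

Lemma is_derive1V f x a : f x != 0 -> is_derive x 1 f a ->
  is_derive x 1 (fun y => (f y)^-1) (- a * (f x)^-1 * (f x)^-1).
Proof.
move=> fx fa; have := @is_deriveV R f x a 1 fx fa => fVa.
apply: (@is_derive_eq _ _ _ _ _ _ _ _ fVa).
by rewrite /GRing.scale /= -exprVn expr2; ring.
Qed.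

Lemma is_derive1X f n x a : is_derive x 1 f a ->
  is_derive x 1 (fun y => f y ^+ n) (n%:R * f x ^+ n.-1 * a).
Proof.
move=> fa; have -> : (fun y => f y ^+ n) = f ^+ n.
  by apply/funext => y; rewrite exprfctE.
exact: (@is_deriveX R R f n x 1 a fa).
Qed.

Lemma nbhs_gt0 x (P : R -> Prop) : 0 < x -> (forall y, 0 < y -> P y) -> \near x, P x.
Proof.
move=> x0 PP; have := lt_nbhsr x0; apply: filterS => y; exact: PP.
Qed.

Definition C1pos f := forall x, 0 < x -> derivable f x 1.

Lemma C1pos_is_derive f x : C1pos f -> 0 < x -> is_derive x 1 f (f^`() x).
Proof. by move=> df x0; rewrite derive1E; apply/derivableP/df. Qed.

Lemma derive1_val f x a : is_derive x 1 f a -> f^`() x = a.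
Proof. by move=> fa; rewrite derive1E derive_val. Qed.

Lemma eq_pos_derive1 f g : (forall x, 0 < x -> f x = g x) ->
  forall x, 0 < x -> f^`() x = g^`() x.
Proof.
move=> fg x x0; rewrite !derive1E; apply: near_eq_derive; exact: nbhs_gt0.
Qed.

(** Only the values on (0, oo) matter, so all the notions of this part are
    insensitive to what functions do on (-oo, 0]. *)
Fixpoint Cpos n f : Prop :=
  if n is n'.+1 then C1pos f /\ Cpos n' f^`() else True.

Definition smooth f := forall n, Cpos n f.

Lemma CposW n f : Cpos n.+1 f -> Cpos n f.
Proof.
by elim: n f => //= n IH f [df [d2f ?]]; split=> //; apply: IH; split.
Qed.

Lemma eq_Cpos n f g : (forall x, 0 < x -> f x = g x) -> Cpos n f -> Cpos n g.
Proof.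
elim: n f g => //= n IH f g fg [df nf]; split.
  by move=> x x0; apply: near_eq_derivable (df _ x0); exact: nbhs_gt0.
by apply: IH nf; exact: eq_pos_derive1.
Qed.

Lemma Cpos_is_derive n f g : (forall x, 0 < x -> is_derive x 1 f (g x)) ->
  Cpos n g -> Cpos n.+1 f.
Proof.
move=> fg ng; split; first by move=> x /fg[].
by apply: eq_Cpos ng => x /fg /derive1_val.
Qed.

Lemma CposD n f g : Cpos n f -> Cpos n g -> Cpos n (fun x => f x + g x).
Proof.
elim: n f g => // n IH f g [df nf] [dg ng].
apply: (@Cpos_is_derive _ _ (fun x => f^`() x + g^`() x)); last exact: IH.
by move=> x x0; apply: is_derive1D; exact: C1pos_is_derive.
Qed.

Lemma CposM n f g : Cpos n f -> Cpos n g -> Cpos n (fun x => f x * g x).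
Proof.
elim: n f g => // n IH f g nf ng; have [df nf'] := nf; have [dg ng'] := ng.
apply: (@Cpos_is_derive _ _ (fun x => f^`() x * g x + f x * g^`() x)).
  by move=> x x0; apply: is_derive1M; exact: C1pos_is_derive.
by apply: CposD; apply: IH => //; exact: CposW.
Qed.

Lemma Cpos_cst n a : Cpos n (fun=> a).
Proof.
by elim: n a => // n IH a; apply: (@Cpos_is_derive _ _ (fun=> 0)).
Qed.

Lemma CposV n f : (forall x, 0 < x -> f x != 0) -> Cpos n f ->
  Cpos n (fun x => (f x)^-1).
Proof.
move=> f0; elim: n => // n IH nf; have [df nf'] := nf.
apply: (@Cpos_is_derive _ _ (fun x => (-1 * f^`() x) * (f x)^-1 * (f x)^-1)).
  move=> x x0; rewrite mulN1r; apply: is_derive1V; first exact: f0.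
  exact: C1pos_is_derive.
have nV := IH (CposW nf).
by apply: CposM => //; apply: CposM => //; apply: CposM => //; exact: Cpos_cst.
Qed.

Lemma smooth_C1 f : smooth f -> C1pos f. Proof. by move=> /(_ 1%N) []. Qed.

Lemma smooth_is_derive f x : smooth f -> 0 < x -> is_derive x 1 f (f^`() x).
Proof. by move=> sf; exact/C1pos_is_derive/smooth_C1. Qed.

Lemma smooth_derive1 f : smooth f -> smooth f^`().
Proof. by move=> sf n; have [] := sf n.+1. Qed.

Lemma eq_smooth f g : (forall x, 0 < x -> f x = g x) -> smooth f -> smooth g.
Proof. by move=> fg sf n; apply: eq_Cpos fg _. Qed.

Lemma smoothD f g : smooth f -> smooth g -> smooth (fun x => f x + g x).
Proof. by move=> sf sg n; exact: CposD. Qed.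

Lemma smoothM f g : smooth f -> smooth g -> smooth (fun x => f x * g x).
Proof. by move=> sf sg n; exact: CposM. Qed.

Lemma smooth_cst a : smooth (fun=> a).
Proof. by move=> n; exact: Cpos_cst. Qed.

Lemma smoothN f : smooth f -> smooth (fun x => - f x).
Proof.
move=> sf; apply: (@eq_smooth (fun x => -1 * f x)) => [x _|]; first by ring.
by apply: smoothM => //; exact: smooth_cst.
Qed.

Lemma smoothX f k : smooth f -> smooth (fun x => f x ^+ k).
Proof.
move=> sf; elim: k => [|k IH]; first exact: smooth_cst.
apply: (@eq_smooth (fun x => f x * f x ^+ k)) => [x _|]; first by rewrite exprS.
exact: smoothM.
Qed.

Lemma smoothV f : (forall x, 0 < x -> f x != 0) -> smooth f ->
  smooth (fun x => (f x)^-1).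
Proof. by move=> f0 sf n; exact: CposV. Qed.

Lemma smooth_id : smooth id.
Proof.
case=> // n; apply: (@Cpos_is_derive _ _ (fun=> 1)); exact: Cpos_cst.
Qed.

Lemma is_derive_expRN x : is_derive x 1 (fun y => expR (- y)) (- expR (- x)).
Proof.
have dN : is_derive x 1 (fun y : R => - y) (- 1).
  by apply: is_derive1N; exact: is_derive_id.
have := @is_derive1_comp R expR -%R x _ _ (is_derive_expR _) dN.
by rewrite mulrN1.
Qed.

Lemma is_derive_sinh x : is_derive x 1 sinh (cosh x).
Proof.
have H := is_derive1M (is_derive1D (is_derive_expR x)
  (is_derive1N (is_derive_expRN x))) (is_derive_cst (2^-1 : R) x 1).
by apply: (is_derive_eq H); rewrite /cosh /=; ring.
Qed.

Lemma is_derive_cosh x : is_derive x 1 cosh (sinh x).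
Proof.
have H := is_derive1M (is_derive1D (is_derive_expR x)
  (is_derive_expRN x)) (is_derive_cst (2^-1 : R) x 1).
by apply: (is_derive_eq H); rewrite /sinh /=; ring.
Qed.

Lemma smooth_sinh_cosh : smooth sinh /\ smooth cosh.
Proof.
suff H n : Cpos n (@sinh R) /\ Cpos n (@cosh R) by split=> n; have [] := H n.
elim: n => // n [IHs IHc]; split.
- by apply: Cpos_is_derive IHc => x _; exact: is_derive_sinh.
- by apply: Cpos_is_derive IHs => x _; exact: is_derive_cosh.
Qed.

Lemma sinh_gt0 x : 0 < x -> 0 < sinh x.
Proof.
move=> x0; apply: divr_gt0 => //; rewrite subr_gt0 ltr_expR; lra.
Qed.

Lemma sinh_neq0 x : 0 < x -> sinh x != 0.
Proof. by move=> /sinh_gt0 /lt0r_neq0. Qed.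

Lemma cosh2 x : cosh x ^+ 2 = sinh x ^+ 2 + 1.
Proof.
have := expRN x; rewrite /cosh /sinh => ->.
by field; rewrite expR_eq0.
Qed.

Lemma smooth_coth : smooth coth.
Proof.
have [ss sc] := smooth_sinh_cosh; apply: smoothM => //.
by apply: smoothV => //; exact: sinh_neq0.
Qed.

Lemma is_derive_coth x : 0 < x -> is_derive x 1 coth (1 - coth x ^+ 2).
Proof.
move=> x0.
have H := is_derive1M (is_derive_cosh x)
  (is_derive1V (sinh_neq0 x0) (is_derive_sinh x)).
by apply: (is_derive_eq H); rewrite /coth; field; exact: sinh_neq0.
Qed.

(** This is sinh x <= x cosh x: the difference vanishes at 0 and has derivative
    x sinh x >= 0. It serves to compare 1 / sinh^2 with 1 / x^2. *)
Lemma coth_ge_inv x : 0 < x -> x^-1 <= coth x.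
Proof.
move=> x0; rewrite -(mul1r x^-1) /coth ler_pdivrMr// mulrAC ler_pdivlMr ?sinh_gt0//.
rewrite mul1r mulrC -subr_ge0.
set F : R -> R := fun y => y * cosh y - sinh y.
have dF (y : R) : is_derive y 1 F (y * sinh y).
  have H := is_derive1D (is_derive1M (is_derive_id y (1 : R)) (is_derive_cosh y))
    (is_derive1N (is_derive_sinh y)).
  by apply: (is_derive_eq H); rewrite /=; ring.
have [|c] := MVT_segment (ltW x0) (fun y _ => dF y).
  by apply: derivable_within_continuous => y _; have [] := dF y.
rewrite in_itv /= => /andP[c0 _] E.
have F0 : F 0 = 0 by rewrite /F /sinh oppr0 subrr; ring.
move: E; rewrite F0 !subr0 /F => ->; apply: mulr_ge0 (ltW x0).
apply: mulr_ge0 => //; move: c0; rewrite le_eqVlt => /predU1P[<-|/sinh_gt0/ltW//].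
by rewrite /sinh oppr0 subrr mul0r.
Qed.

End smooth.

(** * Inequalities up to exact derivatives *)

Section test_functions.
Context {R : realType}.
Implicit Types (f g F G H : R -> R) (x a b : R).

Definition supported f := exists a b, 0 < a /\
  forall x, 0 < x -> (x < a) || (b < x) -> f x = 0.

Definition test f := smooth f /\ supported f.

Lemma supportedD f g : supported f -> supported g ->
  supported (fun x => f x + g x).
Proof.
move=> [a [b [a0 fab]]] [c [d [c0 gcd]]].
exists (Num.min a c), (Num.max b d); rewrite lt_min a0 c0; split=> // x x0.
rewrite lt_min gt_max => /orP[] /andP[H1 H2];
  by rewrite fab ?gcd ?addr0// ?H1 ?H2 ?orbT.
Qed.

Lemma supportedM f g : supported f -> supported (fun x => f x * g x).
Proof.
by move=> [a [b [a0 fab]]]; exists a, b; split=> // x x0 /fab ->//; rewrite mul0r.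
Qed.

Lemma supported_derive1 f : supported f -> supported f^`().
Proof.
move=> [a [b [a0 fab]]]; exists a, b; split=> // x x0 xab.
suff Ef : \near x, f x = cst 0 x.
  by rewrite derive1E (near_eq_derive _ Ef) derive_val.
case/orP : xab => xab.
- have [l u] := (lt_nbhsr x0, lt_nbhsl xab); near=> y.
  by apply: fab; [near: y|apply/orP; left; near: y].
- have [l u] := (lt_nbhsr x0, lt_nbhsr xab); near=> y.
  by apply: fab; [near: y|apply/orP; right; near: y].
Unshelve. all: by end_near. Qed.

Lemma testD f g : test f -> test g -> test (fun x => f x + g x).
Proof.
by move=> [sf bf] [sg bg]; split; [exact: smoothD|exact: supportedD].
Qed.

Lemma testM f g : test f -> smooth g -> test (fun x => f x * g x).
Proof. by move=> [sf bf] sg; split; [exact: smoothM|exact: supportedM]. Qed.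

Lemma test_derive1 f : test f -> test f^`().
Proof.
by move=> [sf bf]; split; [exact: smooth_derive1|exact: supported_derive1].
Qed.

Lemma test0 : test (fun=> 0).
Proof. by split; [exact: smooth_cst|exists 1, 1]. Qed.

(** This implies that the integral of F is at most that of G, because the
    integral of Phi' vanishes. Integrations by parts become pointwise identities,
    and no integrability has to be tracked until the very end. *)
Definition dominated F G := exists2 Phi, test Phi &
  forall x, 0 < x -> F x <= G x + Phi^`() x.

Lemma dominated_le F G : (forall x, 0 < x -> F x <= G x) -> dominated F G.
Proof.
move=> FG; exists (fun=> 0); first exact: test0.
by move=> x x0; rewrite derive1_cst addr0 FG.
Qed.

Lemma dominatedD F1 G1 F2 G2 : dominated F1 G1 -> dominated F2 G2 ->
  dominated (fun x => F1 x + F2 x) (fun x => G1 x + G2 x).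
Proof.
move=> [P1 tP1 FG1] [P2 tP2 FG2]; exists (fun x => P1 x + P2 x); first exact: testD.
move=> x x0; have H := is_derive1D (smooth_is_derive (proj1 tP1) x0)
  (smooth_is_derive (proj1 tP2) x0).
by rewrite (derive1_val H) addrACA lerD ?FG1 ?FG2.
Qed.

Lemma dominated_trans G F H : dominated F G -> dominated G H -> dominated F H.
Proof.
move=> FG GH; have [P tP FGH] := dominatedD FG GH.
exists P => // x x0; have := FGH x x0; lra.
Qed.

Lemma dominatedZ a F G : 0 <= a -> dominated F G ->
  dominated (fun x => a * F x) (fun x => a * G x).
Proof.
move=> a0 [P tP FG]; exists (fun x => P x * a).
  by apply: testM => //; exact: smooth_cst.
move=> x x0; have H := is_derive1M (smooth_is_derive (proj1 tP) x0) (is_derive_cst a x (1 : R)).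
by rewrite (derive1_val H) mulr0 addr0 [_ * a]mulrC -mulrDr ler_wpM2l ?FG.
Qed.

Lemma dominated_lel F' F G : (forall x, 0 < x -> F x <= F' x) ->
  dominated F' G -> dominated F G.
Proof. by move=> /dominated_le; exact: dominated_trans. Qed.

Lemma dominated_ler G' F G : (forall x, 0 < x -> G' x <= G x) ->
  dominated F G' -> dominated F G.
Proof. by move=> /dominated_le/[swap]; exact: dominated_trans. Qed.

End test_functions.

(** * Hardy and Rellich inequalities for the radial Laplacian *)

Section radial_operator.
Context {R : realType} (n : nat).
Implicit Types (f : R -> R) (x : R).

Let nu : R := n%:R.

Definition radial_op f x := f^`()^`() x + nu * coth x * f^`() x.

(** The integrand x^-k f^2 of the weighted norms, against the radial density of
    the hyperbolic volume. *)
Definition wsq k f x := x ^- k * f x ^+ 2 * sinh x ^+ n.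

(** The bottom of the spectrum of the Laplacian of the hyperbolic space. *)
Definition spectral_gap : R := (nu / 2) ^+ 2.
Local Notation lam := spectral_gap.
Let c : R := nu * (nu - 2) / 4.

(** The potential for which [weighted_hardy] is an equality at the function
    x^((k+1)/2) sinh^(-n/2); the coefficient of coth^2 - 1 = 1 / sinh^2 comes from
    conjugating the radial Laplacian by sinh^(n/2). *)
Definition hardy_potential k x :=
  (1 - k%:R ^+ 2) / 4 * x ^- 2 + lam + c * (coth x ^+ 2 - 1).

Lemma test_radial_op f : test f -> test (radial_op f).
Proof.
move=> tf; have tf1 := test_derive1 tf; have tf2 := test_derive1 tf1.
have -> : radial_op f = (fun x => f^`()^`() x + f^`() x * (nu * coth x)).
  by apply/funext => x; rewrite /radial_op mulrC.
apply: testD => //; apply: testM => //.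
by apply: smoothM; [exact: smooth_cst|exact: smooth_coth].
Qed.

Lemma test_iter_radial_op m f : test f -> test (iter m radial_op f).
Proof. by move=> tf; elim: m => //= m IH; exact: test_radial_op. Qed.

Lemma is_derive_negpow k x : 0 < x ->
  is_derive x 1 (fun y : R => y ^- k) (- (k%:R * x ^- k * x^-1)).
Proof.
move=> x0; have xk : x ^+ k != 0 by rewrite expf_neq0// lt0r_neq0.
have H := @is_derive1V _ (fun y => y ^+ k) _ _ xk (is_derive1X k (is_derive_id x (1 : R))).
apply: (is_derive_eq H); case: k {H} xk => [|k] xk; first by rewrite !mul0r; ring.
by rewrite /= exprS; field; rewrite expf_neq0 lt0r_neq0.
Qed.

Lemma is_derive_weight x : 0 < x ->
  is_derive x 1 (fun y => sinh y ^+ n) (nu * coth x * sinh x ^+ n).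
Proof.
move=> x0; have H := is_derive1X n (is_derive_sinh x).
apply: (is_derive_eq H); rewrite /coth /nu; have := sinh_neq0 x0.
by case: n => [|m] s0 /=; [rewrite !mul0r|rewrite exprS; field].
Qed.

Lemma smooth_negpow k : smooth (fun x : R => x ^- k).
Proof.
apply: smoothV => [x x0|]; first by rewrite expf_neq0// lt0r_neq0.
exact/smoothX/smooth_id.
Qed.

Lemma smooth_weight : smooth (fun x : R => sinh x ^+ n).
Proof. by apply: smoothX; case: (@smooth_sinh_cosh R). Qed.

Lemma weight_gt0 x : 0 < x -> 0 < sinh x ^+ n.
Proof. by move=> x0; rewrite exprn_gt0// sinh_gt0. Qed.

Lemma wsq_ge0 k f x : 0 < x -> 0 <= wsq k f x.
Proof.
move=> x0; apply: mulr_ge0 (ltW (weight_gt0 x0)).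
by rewrite mulr_ge0 ?sqr_ge0// invr_ge0 exprn_ge0// ltW.
Qed.

(** The difference of the two sides is x^-k w (f' - q f)^2 minus the derivative
    of Phi = x^-k w f (f' - e f), where q = (k+1) / (2x) - (n/2) coth x is the
    logarithmic derivative of the optimal function and e = q - k / (2x). *)
Lemma weighted_hardy k f : test f ->
  dominated (fun x => hardy_potential k x * wsq k f x)
            (fun x => - (x ^- k * f x * radial_op f x * sinh x ^+ n)).
Proof.
move=> tf; have [sf _] := tf; have sf1 := smooth_derive1 sf.
pose e x := 2^-1 * x ^- 1 + - (nu / 2) * coth x.
have sc := @smooth_coth R.
have se : smooth e.
  apply: smoothD; apply: smoothM => //; try exact: smooth_cst.
  exact: smooth_negpow.
exists (fun x => f x * ((x ^- k * sinh x ^+ n) * (f^`() x + - (e x * f x)))).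
  apply: testM => //; apply: smoothM.
    by apply: smoothM; [exact: smooth_negpow|exact: smooth_weight].
  by apply: smoothD => //; apply/smoothN/smoothM.
move=> x x0.
have de : is_derive x 1 e (- 2^-1 * x^-1 ^+ 2 - nu / 2 * (1 - coth x ^+ 2)).
  have H := is_derive1D
    (is_derive1M (is_derive_cst (2^-1 : R) x (1 : R)) (is_derive_negpow 1 x0))
    (is_derive1M (is_derive_cst (- (nu / 2) : R) x (1 : R)) (is_derive_coth x0)).
  by apply: (is_derive_eq H); rewrite /= !expr1; ring.
have df := smooth_is_derive sf x0.
have df1 := smooth_is_derive sf1 x0.
have H := is_derive1M df (is_derive1M
  (is_derive1M (is_derive_negpow k x0) (is_derive_weight x0))
  (is_derive1D df1 (is_derive1N (is_derive1M de df)))).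
rewrite (derive1_val H) -subr_ge0 /hardy_potential /wsq /radial_op /e -/nu.
have xp : 0 < x ^- k by rewrite invr_gt0 exprn_gt0.
have wp := weight_gt0 x0.
rewrite [leRHS](_ : _ = x ^- k * sinh x ^+ n *
  (f^`() x - ((k%:R + 1) / 2 * x^-1 - nu / 2 * coth x) * f x) ^+ 2).
  by rewrite mulr_ge0 ?sqr_ge0// mulr_ge0// ltW.
rewrite expr1 -[x ^- 2]exprVn /lam /c.
move: (x ^- k) (sinh x ^+ n) (x^-1) (coth x) (f x) (f^`() x) (f^`()^`() x) (k%:R) nu.
move=> a1 a2 a3 a4 a5 a6 a7 a8 a9; rewrite /=. by field.
Qed.

Lemma wsqD k j f x : wsq (k + j) f x = x ^- j * wsq k f x.
Proof. by rewrite /wsq exprD invfM; ring. Qed.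

(** Expand x^-k w (L f + (a + s x^-2) f)^2 >= 0 and bound the cross terms by
    [weighted_hardy] with the weights x^-k and x^(-k-2). *)
Lemma weighted_rellich k (a s : R) f : 0 <= a -> 0 <= s -> test f ->
  dominated (fun x => (2 * a * hardy_potential k x - a ^+ 2) * wsq k f x
      + (2 * s * (hardy_potential (k + 2) x - a)) * wsq (k + 2) f x
      - s ^+ 2 * wsq (k + 4) f x)
    (wsq k (radial_op f)).
Proof.
move=> a0 s0 tf.
have a2 : 0 <= 2 * a by rewrite mulr_ge0.
have s2 : 0 <= 2 * s by rewrite mulr_ge0.
have := dominatedD (dominatedZ a2 (weighted_hardy k tf))
  (dominatedZ s2 (weighted_hardy (k + 2) tf)).
have : dominated (fun x => - (a ^+ 2 * wsq k f x + 2 * s * a * wsq (k + 2) f x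
    + s ^+ 2 * wsq (k + 4) f x)) (fun x => - (a ^+ 2 * wsq k f x
    + 2 * s * a * wsq (k + 2) f x + s ^+ 2 * wsq (k + 4) f x)).
  exact: dominated_le.
move=> /dominatedD H /H {}H.
apply: dominated_lel (dominated_ler _ H) => x x0; first lra.
rewrite !wsqD /wsq (exprD x k 2) (invfM (x ^+ k)) -subr_ge0.
rewrite [leRHS](_ : _ = x ^- k * sinh x ^+ n *
  (radial_op f x + (a + s * x^-1 ^+ 2) * f x) ^+ 2).
  by rewrite mulr_ge0 ?sqr_ge0// mulr_ge0 ?(ltW (weight_gt0 x0))//
    invr_ge0 exprn_ge0// ltW.
by rewrite -!exprVn; ring.
Qed.

Lemma coth2_ge x : 0 < x -> x ^- 2 - 1 <= coth x ^+ 2 - 1.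
Proof.
move=> x0; rewrite lerD2r -exprVn lerXn2r ?nnegrE ?invr_ge0 ?(ltW x0)//.
  by apply: le_trans (coth_ge_inv x0); rewrite invr_ge0 ltW.
exact: coth_ge_inv.
Qed.

Lemma coth2_ge1 x : 0 < x -> 0 <= coth x ^+ 2 - 1.
Proof.
move=> x0; have s0 := sinh_gt0 x0.
rewrite /coth expr_div_n cosh2 mulrDl divff ?expf_neq0 ?lt0r_neq0//.
by rewrite addrC addKr mul1r invr_ge0 exprn_ge0// ltW.
Qed.

(** The constant of the Euclidean radial Rellich inequality in dimension
    N = n + 1, from the weight x^-k to the weight x^(-k-4). *)
Definition rellich_cst k : R := (nu + 1 + k%:R) * (nu - 3 - k%:R) / 4.

Lemma rellich_cst_gt0 k : (k + 3 < n)%N -> 0 < rellich_cst k.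
Proof.
move=> kn; rewrite /rellich_cst /nu divr_gt0// mulr_gt0//.
by rewrite -addrA -opprD -natrD subr_gt0 ltr_nat addnC.
Qed.

(** Here a = 0 and s = [rellich_cst k]. Since coth^2 - 1 >= x^-2 - 1, the potential
    dominates s x^-2 + (lam - c), and lam - c = n / 2. *)
Lemma rellich_step k f : (k + 3 < n)%N -> test f ->
  dominated (fun x => rellich_cst k ^+ 2 * wsq (k + 4) f x
                      + rellich_cst k * nu * wsq (k + 2) f x)
    (wsq k (radial_op f)).
Proof.
move=> kn tf; have s0 := rellich_cst_gt0 kn.
apply: dominated_lel (weighted_rellich k (lexx 0) (ltW s0) tf) => x x0.
have n2 : 2 <= nu by rewrite /nu ler_nat; apply: leq_trans kn; rewrite addnS.
have c0 : 0 <= c by rewrite /c divr_ge0// mulr_ge0// subr_ge0.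
have W0 := wsq_ge0 k f x0.
rewrite -subr_ge0 !wsqD.
rewrite [leRHS](_ : _ = 2 * rellich_cst k * (x ^- 2 * (wsq k f x *
    (c * ((coth x ^+ 2 - 1) - (x ^- 2 - 1)))))).
  apply: mulr_ge0; first by rewrite mulr_ge0// ltW.
  apply: mulr_ge0; first by rewrite invr_ge0 exprn_ge0// ltW.
  by rewrite mulr_ge0// mulr_ge0// subr_ge0 coth2_ge.
rewrite /hardy_potential /rellich_cst /lam /c natrD -!exprVn.
by move: (wsq k f x) (x^-1) (coth x) (k%:R) nu => *; field.
Qed.

Lemma poincare_hardy_rellich f : (2 <= n)%N -> test f ->
  dominated (fun x => lam ^+ 2 * wsq 0 f x + lam / 2 * wsq 2 f x)
    (wsq 0 (radial_op f)).
Proof.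
move=> n2 tf; have l0 : 0 <= lam by exact: sqr_ge0.
apply: dominated_lel (weighted_rellich 0 l0 (lexx 0) tf) => x x0.
have {}n2 : 2 <= nu by rewrite /nu ler_nat.
have c0 : 0 <= c by rewrite /c divr_ge0// mulr_ge0// subr_ge0.
rewrite -subr_ge0 !add0n (wsqD 0 2) (wsqD 0 4).
have T0 := mulr_ge0 c0 (coth2_ge1 x0).
rewrite [leRHS](_ : _ = 2 * lam * (wsq 0 f x * (c * (coth x ^+ 2 - 1)))).
  exact: mulr_ge0 (mulr_ge0 _ l0) (mulr_ge0 (wsq_ge0 0 f x0) T0).
by rewrite /hardy_potential; field; exact: lt0r_neq0.
Qed.

(** The parameters are a = lam and s = 1/8. The value 1/8 is the one for which the
    loss 2 s c x^-2 coming from coth^2 - 1 >= x^-2 - 1 is exactly the difference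
    between lam / 2 and n (n + 2) / 16. *)
Lemma poincare_rellich f : (6 <= n)%N -> test f ->
  dominated (fun x => lam ^+ 2 * wsq 0 f x + nu * (nu + 2) / 16 * wsq 2 f x
      + (nu - 3) ^+ 2 / 16 * wsq 4 f x)
    (wsq 0 (radial_op f)).
Proof.
move=> n6 tf; have l0 : 0 <= lam by exact: sqr_ge0.
have s0 : 0 <= 8^-1 :> R by lra.
apply: dominated_lel (weighted_rellich 0 l0 s0 tf) => x x0.
have {}n6 : 6 <= nu by rewrite /nu ler_nat.
have c0 : 0 <= c by rewrite /c divr_ge0// mulr_ge0; lra.
have ix : 0 <= x ^- 2 by rewrite invr_ge0 exprn_ge0// ltW.
have W0 := wsq_ge0 0 f x0.
rewrite -subr_ge0 !add0n (wsqD 0 2) (wsqD 0 4).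
rewrite [leRHS](_ : _ = wsq 0 f x * (2 * lam * (c * (coth x ^+ 2 - 1))
  + c / 4 * (x ^- 2 * ((coth x ^+ 2 - 1) - (x ^- 2 - 1)))
  + (nu / 4 - 49 / 64) * (x ^- 2 * x ^- 2))).
  rewrite mulr_ge0// addr_ge0//; last by apply: mulr_ge0; [lra|exact: mulr_ge0].
  apply: addr_ge0; first exact: mulr_ge0 (mulr_ge0 _ l0) (mulr_ge0 c0 (coth2_ge1 x0)).
  by apply: mulr_ge0 (mulr_ge0 ix _); [exact: divr_ge0|rewrite subr_ge0 coth2_ge].
rewrite /hardy_potential /lam /c -!exprVn.
by move: (wsq 0 f x) (x^-1) (coth x) nu => *; field.
Qed.

(** [weighted_hardy] with k = 0, after one integration by parts. *)
Lemma poincare_hardy f : (2 <= n)%N -> test f ->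
  dominated (fun x => lam * wsq 0 f x + 4^-1 * wsq 2 f x) (wsq 0 f^`()).
Proof.
move=> n2 tf; have [sf _] := tf; have tf1 := test_derive1 tf.
have {}n2 : 2 <= nu by rewrite /nu ler_nat.
have c0 : 0 <= c by rewrite /c divr_ge0// mulr_ge0// subr_ge0.
apply: (@dominated_trans _ (fun x => - (f x * radial_op f x * sinh x ^+ n))).
  apply: dominated_lel (dominated_ler _ (weighted_hardy 0 tf)) => x x0.
    rewrite (wsqD 0 2) -subr_ge0 [leRHS](_ : _ =
      wsq 0 f x * (c * (coth x ^+ 2 - 1))).
      exact: mulr_ge0 (wsq_ge0 0 f x0) (mulr_ge0 c0 (coth2_ge1 x0)).
    by rewrite /hardy_potential; field; exact: lt0r_neq0.
  by rewrite expr0 invr1 mul1r.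
(* f L f w + f'^2 w is the derivative of w f f'. *)
exists (fun x => f x * (- (f^`() x * sinh x ^+ n))).
  by apply: testM => //; apply/smoothN/smoothM; [case: tf1|exact: smooth_weight].
move=> x x0.
have H := is_derive1M (smooth_is_derive sf x0) (is_derive1N (is_derive1M
  (smooth_is_derive (smooth_derive1 sf) x0) (is_derive_weight x0))).
rewrite (derive1_val H) /wsq /radial_op expr0 invr1 le_eqVlt; apply/orP; left.
by apply/eqP; ring.
Qed.

(** The last step supplies the additional x^(-k-4m-2) term. *)
Lemma rellich_chain m k : (k + 4 * m + 3 < n)%N ->
  exists2 F : R, 0 < F & forall f, test f ->
    dominated (fun x =>
        \prod_(i < m.+1) rellich_cst (k + 4 * i) ^+ 2 * wsq (k + 4 * m.+1) f x
        + F * wsq (k + 4 * m + 2) f x)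
      (wsq k (iter m.+1 radial_op f)).
Proof.
elim: m k => [|m IH] k kn.
  rewrite muln0 addn0 in kn *; exists (rellich_cst k * nu).
    by rewrite mulr_gt0 ?rellich_cst_gt0// ltr0n; apply: leq_trans kn.
  move=> f tf; rewrite big_ord1 muln0 addn0 muln1; exact: rellich_step.
have kn1 : (k + 3 < n)%N.
  by apply: leq_ltn_trans kn; rewrite leq_add2r leq_addr.
have [|F F0 H] := IH (k + 4)%N; first by rewrite -(addnA k 4) -mulnS.
have s0 := rellich_cst_gt0 kn1.
exists (rellich_cst k ^+ 2 * F) => [|f tf]; first by rewrite mulr_gt0// exprn_gt0.
have ti := test_iter_radial_op m.+1 tf.
rewrite iterS; apply: dominated_trans (rellich_step kn1 ti).
have := dominatedZ (sqr_ge0 (rellich_cst k)) (H f tf).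
rewrite -2!(addnA k 4) -!mulnS => {}H.
apply: dominated_lel (dominated_ler _ H) => x x0.
  rewrite big_ord_recl /= muln0 addn0 mulrDr !mulrA.
  rewrite (@eq_bigr _ _ _ _ _ _ _ (fun i : 'I_m.+1 => rellich_cst (k + 4 + 4 * i) ^+ 2))//.
  by move=> i _; rewrite -addnA -mulnS.
rewrite lerDl mulr_ge0 ?wsq_ge0// mulr_ge0 ?ler0n// ltW//.
Qed.

Lemma iter_poincare m f : (2 <= n)%N -> test f ->
  dominated (fun x => lam ^+ (2 * m) * (lam ^+ 2 * wsq 0 f x + lam / 2 * wsq 2 f x))
    (wsq 0 (iter m.+1 radial_op f)).
Proof.
move=> n2 tf; elim: m => [|m IH].
  apply: dominated_lel (poincare_hardy_rellich n2 tf) => x x0.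
  by rewrite muln0 expr0 mul1r.
have ti := test_iter_radial_op m.+1 tf.
apply: dominated_trans (poincare_hardy_rellich n2 ti).
apply: dominated_lel (dominated_ler _ (dominatedZ (sqr_ge0 lam) IH)) => x x0.
  by rewrite mulrA -exprD -mulnS.
rewrite lerDl mulr_ge0 ?wsq_ge0// divr_ge0//; exact: sqr_ge0.
Qed.

End radial_operator.

(** * The constants *)

Section constants.
Context {R : realType}.
Implicit Types (n N m k : nat) (h x : R).

(** [lead_even] and [lead_odd] are the coefficients required for x^(-2k),
    [first_even] and [first_odd] those required for x^-2, for k = 2m and
    k = 2m + 1 respectively. *)
Definition lead_even N m : R := ((N%:R - 4) / 2 ^+ (2 * m)) ^+ 2
  * \prod_(1 <= j < m) ((N%:R + 4 * j%:R) ^+ 2 * (N%:R - 4 * j%:R - 4) ^+ 2).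

Definition lead_odd N m : R := 1 / 2 ^+ (4 * m + 2)
  * \prod_(1 <= j < m.+1)
      ((N%:R + 4 * j%:R - 2) ^+ 2 * (N%:R - 4 * j%:R - 2) ^+ 2).

Definition first_even N m : R := (N%:R ^+ 2 - 1) / 16
  * \sum_(1 <= j < m.+1) ((N%:R - 1) / 2) ^+ (4 * m - 2 * j - 2).

Definition first_odd N m : R := (N%:R ^+ 2 - 1)
  * (\sum_(1 <= j < m.+1) (N%:R - 1) ^+ (2 * m + 2 * j - 2)
       / 2 ^+ (2 * m + 2 * j + 2))
  + (N%:R - 1) ^+ (2 * m) / 2 ^+ (2 * m + 2).

Lemma lead_evenE n m : lead_even n.+1 m.+1 =
  (n%:R - 3) ^+ 2 / 16 * \prod_(i < m) rellich_cst n (4 + 4 * i) ^+ 2.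
Proof.
rewrite /lead_even big_add1 /= big_mkord -natr1.
transitivity (((n%:R - 3) / 2 ^+ (2 * m.+1)) ^+ 2 * (16 ^+ m *
  \prod_(i < m) rellich_cst n (4 + 4 * i) ^+ 2) : R).
  congr (_ * _); first by congr (_ ^+ 2); congr (_ / _); ring.
  rewrite -[m in 16 ^+ m]card_ord -prodr_const -big_split /=.
  by apply: eq_bigr => i _; rewrite /rellich_cst -natr1 natrD natrM; field.
rewrite mulrA; congr (_ * _).
rewrite expr_div_n -exprM mulnAC exprM.
have -> : 2 ^+ (2 * 2) = 16 :> R by ring.
by rewrite (exprS 16 m); field; rewrite expf_neq0.
Qed.

Lemma lead_oddE n m : lead_odd n.+1 m =
  4^-1 * \prod_(i < m) rellich_cst n (2 + 4 * i) ^+ 2.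
Proof.
rewrite /lead_odd big_add1 /= big_mkord -natr1.
transitivity (1 / 2 ^+ (4 * m + 2) * (16 ^+ m *
  \prod_(i < m) rellich_cst n (2 + 4 * i) ^+ 2) : R).
  congr (_ * _); rewrite -[m in 16 ^+ m]card_ord -prodr_const -big_split /=.
  by apply: eq_bigr => i _; rewrite /rellich_cst -natr1 natrD natrM; field.
rewrite mulrA; congr (_ * _); rewrite exprD exprM.
have -> : 2 ^+ 4 = 16 :> R by ring.
by field; rewrite expf_neq0.
Qed.

(** The sum telescopes once multiplied by h^2 - 1. *)
Lemma geometric_sum_down h a m : (2 * m <= a)%N -> 0 <= h ->
  (h ^+ 2 - 1) * \sum_(1 <= j < m.+1) h ^+ (a - 2 * j) <= h ^+ a.
Proof.
move=> ma h0.
suff -> : (h ^+ 2 - 1) * \sum_(1 <= j < m.+1) h ^+ (a - 2 * j) =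
    h ^+ a - h ^+ (a - 2 * m) by rewrite lerBlDr lerDl exprn_ge0.
elim: m ma => [|m IH] ma; first by rewrite big_geq// muln0 subn0 mulr0 subrr.
rewrite big_nat_recr //= mulrDr IH; last lia.
rewrite (_ : (a - 2 * m = 2 + (a - 2 * m.+1))%N); last lia.
by rewrite exprD; ring.
Qed.

Lemma geometric_sum_up h m : 0 <= h ->
  (h ^+ 2 - 1) * \sum_(1 <= j < m.+1) h ^+ (2 * m + 2 * j - 2) <= h ^+ (4 * m).
Proof.
move=> h0; rewrite (_ : 4 * m = 2 * m + 2 * m)%N; last lia.
suff H a p : (h ^+ 2 - 1) * \sum_(1 <= j < p.+1) h ^+ (a + 2 * j - 2) =
    h ^+ (a + 2 * p) - h ^+ a by rewrite H lerBlDr lerDl exprn_ge0.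
elim: p => [|p IH]; first by rewrite big_geq// muln0 addn0 mulr0 subrr.
rewrite big_nat_recr //= mulrDr IH.
rewrite (_ : (a + 2 * p.+1 - 2 = a + 2 * p)%N); last lia.
rewrite (_ : (a + 2 * p.+1 = 2 + (a + 2 * p))%N); last lia.
by rewrite [in RHS]exprD; ring.
Qed.

Lemma first_even_lt n m : (6 <= n)%N -> (0 < m)%N ->
  first_even n.+1 m < (n%:R / 2) ^+ (4 * m - 2) / 2.
Proof.
move=> n6 m0; rewrite /first_even -natr1 addrK.
have {}n6 : 6 <= n%:R :> R by rewrite ler_nat.
set h := n%:R / 2; have h3 : 3 <= h by rewrite /h; lra.
have nE : n%:R = 2 * h by rewrite /h; field.
rewrite (eq_bigr (fun j => h ^+ (4 * m - 2 - 2 * j))) => [|j _]; last first.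
  by congr (_ ^+ _); lia.
have h0 : 0 <= h by lra.
have ma : (2 * m <= 4 * m - 2)%N by lia.
move: (geometric_sum_down ma h0); move: (\sum_(_ <= _ < _) _) => S H.
have hp : 0 < h ^+ (4 * m - 2) by rewrite exprn_gt0; lra.
rewrite nE; move: (h ^+ _) hp H => P hp H.
have h8 : 0 < h ^+ 2 - 1 by nra.
rewrite -(ltr_pM2l h8).
apply: (@le_lt_trans _ _ (((2 * h + 1) ^+ 2 - 1) / 16 * P)).
  rewrite mulrCA ler_pM2l//; nra.
have : 0 < P * ((h - 2) * (h + 1)) by rewrite mulr_gt0// mulr_gt0; lra.
lra.
Qed.

Lemma first_odd_lt n m : (6 <= n)%N -> (0 < m)%N ->
  first_odd n.+1 m < (n%:R / 2) ^+ (4 * m) / 2.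
Proof.
move=> n6 m0; rewrite /first_odd -natr1 addrK.
have {}n6 : 6 <= n%:R :> R by rewrite ler_nat.
set h := n%:R / 2; have h3 : 3 <= h by rewrite /h; lra.
have nE : n%:R = 2 * h by rewrite /h; field.
rewrite (eq_bigr (fun j => h ^+ (2 * m + 2 * j - 2) / 16)) => [|j _]; last first.
  rewrite /h expr_div_n -mulrA; congr (_ * _); rewrite -invfM; congr (_^-1).
  case: (posnP (2 * m + 2 * j)) => [|mj]; first lia.
  rewrite (_ : 2 * m + 2 * j + 2 = (2 * m + 2 * j - 2) + 4)%N ?exprD; last lia.
  by congr (_ * _); ring.
rewrite -mulr_suml.
have h0 : 0 <= h by lra.
move: (geometric_sum_up m h0); move: (\sum_(_ <= _ < _) _) => S H.
have hE : n%:R ^+ (2 * m) / 2 ^+ (2 * m + 2) = h ^+ (2 * m) / 4 :> R.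
  by rewrite /h expr_div_n exprD; field; rewrite expf_neq0.
rewrite hE.
have hm : h ^+ (2 * m) * h ^+ 2 <= h ^+ (4 * m).
  by rewrite -exprD ler_weXn2l; [|lra|lia].
have hp : 0 < h ^+ (2 * m) by rewrite exprn_gt0; lra.
rewrite nE; move: (h ^+ (4 * m)) (h ^+ (2 * m)) hp hm H => P Q hp hm H.
have h8 : 0 < h ^+ 2 - 1 by nra.
(* Q = h^(2m) is negligible against P = h^(4m), as h >= 3 and m >= 1. *)
have h9 : Q * 9 <= Q * h ^+ 2 by rewrite ler_pM2l//; nra.
rewrite -(ltr_pM2l h8) mulrDr.
apply: (@le_lt_trans _ _ (((2 * h + 1) ^+ 2 - 1) / 16 * P + (h ^+ 2 - 1) * (P / 36))).
  apply: lerD; last by rewrite ler_pM2l//; lra.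
  have c16 : 0 <= ((2 * h + 1) ^+ 2 - 1) / 16 by nra.
  have := ler_wpM2l c16 H; lra.
have : 0 < P * (8 * h ^+ 2 - 9 * h - 17) by rewrite mulr_gt0//; [lra|nra].
lra.
Qed.

End constants.

(** * The inequality on the half-line *)

Section radial_inequality.
Context {R : realType}.
Implicit Types (n m k : nat) (f G : R -> R) (x : R).

(** Compare with the larger power when x <= 1 and with the smaller one when
    x >= 1. *)
Lemma negpow_le_ends x i k : 0 < x -> (1 <= i <= k)%N ->
  x ^- (2 * i) <= x ^- 2 + x ^- (2 * k).
Proof.
move=> x0 /andP[i1 ik].
have p0 j : 0 <= x ^- j by rewrite invr_ge0 exprn_ge0// ltW.
have p1 j : 0 < x ^+ j by rewrite exprn_gt0.
have [x1|x1] := leP x 1.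
- apply: ler_wpDl => //; rewrite lef_pV2 ?posrE//.
  by apply: ler_wiXn2l => //; [exact: ltW|lia].
- apply: ler_wpDr => //; rewrite lef_pV2 ?posrE//.
  by apply: ler_weXn2l; [exact: ltW|lia].
Qed.

Lemma wsq_le_ends n f x i k : 0 < x -> (1 <= i <= k)%N ->
  wsq n (2 * i) f x <= wsq n 2 f x + wsq n (2 * k) f x.
Proof.
move=> x0 ik; rewrite /wsq -!mulrDl; apply: ler_wpM2r (ltW (weight_gt0 n x0)) _ _ _.
by apply: ler_wpM2r (sqr_ge0 _) _ _ _; exact: negpow_le_ends.
Qed.

Definition hardy_sum n k (D : nat -> R) f x :=
  \sum_(1 <= i < k.+1) D i * wsq n (2 * i) f x.

Definition improved_poincare n k (D : nat -> R) (grad : (R -> R) -> R -> R) :=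
  forall f, test f -> dominated
    (fun x => hardy_sum n k D f x + spectral_gap n ^+ k * wsq n 0 f x)
    (wsq n 0 (grad f)).

(** The intermediate coefficients are all equal to d, small enough for their sum to be
    at most the excess A - D1 at x^-2 and the excess F at x^(-2(k-1)). *)
Lemma spread_constants n k (D1 A F Dk : R) grad : (2 < k)%N ->
  0 < D1 -> D1 < A -> 0 < F -> 0 < Dk ->
  (forall f, test f -> dominated
    (fun x => spectral_gap n ^+ k * wsq n 0 f x + A * wsq n 2 f x
      + F * wsq n (2 * k.-1) f x + Dk * wsq n (2 * k) f x)
    (wsq n 0 (grad f))) ->
  exists D, [/\ forall i, (1 <= i <= k)%N -> 0 < D i, D 1%N = D1, D k = Dk
    & improved_poincare n k D grad].
Proof.
case: k => [//|[//|k]] k0 D10 D1A F0 Dk0 H.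
(* There are k such coefficients; k + 1 keeps the denominator nonzero. *)
pose d := Num.min (A - D1) F / k.+1%:R.
have m0 : 0 < Num.min (A - D1) F by rewrite lt_min subr_gt0 D1A.
have d0 : 0 < d by rewrite divr_gt0.
exists (fun i => if i == 1%N then D1 else if i == k.+2 then Dk else d).
split=> //= [i _||]; [by case: ifP => // _; case: ifP|by rewrite eqxx|].
move=> f tf; apply: dominated_lel (H f tf) => x x0.
rewrite /hardy_sum big_nat_recl// big_nat_recr//= eqxx.
rewrite [X in X + _](_ : _ = D1 * wsq n 2 f x +
  (\sum_(1 <= i < k.+1) d * wsq n (2 * i.+1) f x + Dk * wsq n (2 * k.+2) f x)); last first.
  congr (_ + (_ + _)); apply: eq_big_nat => i /andP[i1 ik].
  by rewrite !eqSS; case: eqP => [|_]; [lia|case: eqP => //; lia].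
have : \sum_(1 <= i < k.+1) d * wsq n (2 * i.+1) f x <=
    \sum_(1 <= i < k.+1) d * (wsq n 2 f x + wsq n (2 * k.+1) f x).
  rewrite big_nat [leRHS]big_nat; apply: ler_sum => i ik.
  by rewrite ler_pM2l// wsq_le_ends//; lia.
rewrite sumr_const_nat subSS subn0 -mulr_natr.
have w2 := wsq_ge0 n 2 f x0; have wk := wsq_ge0 n (2 * k.+1) f x0.
move: (\sum_(_ <= _ < _) _) => S.
have kd : d * k%:R <= Num.min (A - D1) F.
  by rewrite /d mulrAC ler_pdivrMr// ler_pM2l// ler_nat.
have /andP[kA kF] : (d * k%:R <= A - D1) && (d * k%:R <= F) by rewrite -le_min.
have := ler_wpM2r w2 kA; have := ler_wpM2r wk kF; lra.
Qed.

Definition radial_grad n k f :=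
  let g := iter k./2 (radial_op n) f in if odd k then g^`() else g.

(** [poincare_rellich] for L^(m+1) f, then [iter_poincare] for its unweighted term
    and [rellich_chain] for its x^-4 term; its x^-2 term is discarded. *)
Lemma even_profile n m : (8 * m + 14 <= n)%N -> exists2 F : R, 0 < F &
  forall f, test f -> dominated
    (fun x => spectral_gap n ^+ (2 * m.+2) * wsq n 0 f x
      + (n%:R / 2) ^+ (4 * m.+2 - 2) / 2 * wsq n 2 f x
      + F * wsq n (2 * (2 * m.+2).-1) f x
      + lead_even n.+1 m.+2 * wsq n (2 * (2 * m.+2)) f x)
    (wsq n 0 (iter m.+2 (radial_op n) f)).
Proof.
move=> nm; have n2 : (2 <= n)%N by lia.
have [|F F0 chain] := @rellich_chain R n m 4; first lia.
have n3 : 0 < (n%:R - 3) ^+ 2 / 16 :> R.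
  by rewrite divr_gt0// exprn_gt0// subr_gt0 (ltr_nat _ 3); lia.
exists ((n%:R - 3) ^+ 2 / 16 * F) => [|f tf]; first exact: mulr_gt0.
have tg := test_iter_radial_op n m.+1 tf.
have n6 : (6 <= n)%N by lia.
apply: dominated_trans (poincare_rellich n6 tg).
have H := dominatedD
  (dominatedZ (sqr_ge0 (spectral_gap n)) (iter_poincare m n2 tf))
  (dominatedZ (ltW n3) (chain f tf)).
apply: dominated_lel (dominated_ler _ H) => x x0.
  rewrite lead_evenE (_ : 2 * (2 * m.+2).-1 = 4 + 4 * m + 2)%N; last lia.
  rewrite (_ : 2 * (2 * m.+2) = 4 + 4 * m.+1)%N; last lia.
  rewrite (_ : 4 * m.+2 - 2 = 2 * (2 * m + 3))%N; last lia.
  rewrite (_ : 2 * m.+2 = 2 * m + 4)%N; last lia.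
  rewrite exprM -/(spectral_gap n) !exprD le_eqVlt; apply/orP; left.
  by apply/eqP; field.
by rewrite lerD2r lerDl mulr_ge0 ?wsq_ge0// divr_ge0// mulr_ge0.
Qed.

(** [poincare_hardy] for L^(m+1) f, then [iter_poincare] for its unweighted term
    and [rellich_chain] for its x^-2 term. *)
Lemma odd_profile n m : (8 * m + 10 <= n)%N -> exists2 F : R, 0 < F &
  forall f, test f -> dominated
    (fun x => spectral_gap n ^+ (2 * m.+1).+1 * wsq n 0 f x
      + (n%:R / 2) ^+ (4 * m.+1) / 2 * wsq n 2 f x
      + F * wsq n (2 * (2 * m.+1).+1.-1) f x
      + lead_odd n.+1 m.+1 * wsq n (2 * (2 * m.+1).+1) f x)
    (wsq n 0 (iter m.+1 (radial_op n) f)^`()).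
Proof.
move=> nm; have n2 : (2 <= n)%N by lia.
have [|F F0 chain] := @rellich_chain R n m 2; first lia.
exists (4^-1 * F) => [|f tf]; first exact: mulr_gt0.
have tg := test_iter_radial_op n m.+1 tf.
apply: dominated_trans (poincare_hardy n2 tg).
have q0 : 0 <= 4^-1 :> R by [].
have l0 : 0 <= spectral_gap n :> R by exact: sqr_ge0.
have H := dominatedD (dominatedZ l0 (iter_poincare m n2 tf))
  (dominatedZ q0 (chain f tf)).
apply: dominated_lel H => x x0.
rewrite lead_oddE (_ : 2 * (2 * m.+1).+1.-1 = 2 + 4 * m + 2)%N; last lia.
rewrite (_ : 2 * (2 * m.+1).+1 = 2 + 4 * m.+1)%N; last lia.
rewrite [in X in _ + X / 2 * _](_ : 4 * m.+1 = 2 * (2 * m + 2))%N; last lia.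
rewrite (_ : (2 * m.+1).+1 = 2 * m + 3)%N; last lia.
rewrite exprM -/(spectral_gap n) !exprD le_eqVlt; apply/orP; left.
by apply/eqP; field.
Qed.

Lemma lead_even_gt0 n m : (0 < m)%N -> (8 * m - 2 <= n)%N -> 0 < lead_even n.+1 m :> R.
Proof.
case: m => // m _ nm; rewrite lead_evenE mulr_gt0//.
  by rewrite divr_gt0// exprn_gt0// subr_gt0 (ltr_nat _ 3); lia.
by apply: prodr_gt0 => i _; rewrite exprn_gt0// rellich_cst_gt0//; have := ltn_ord i; lia.
Qed.

Lemma lead_odd_gt0 n m : (8 * m + 2 <= n)%N -> 0 < lead_odd n.+1 m :> R.
Proof.
move=> nm; rewrite lead_oddE mulr_gt0//.
by apply: prodr_gt0 => i _; rewrite exprn_gt0// rellich_cst_gt0//; have := ltn_ord i; lia.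
Qed.

Lemma first_even_gt0 n m : (2 <= n)%N -> (0 < m)%N -> 0 < first_even n.+1 m :> R.
Proof.
move=> n2 m0; rewrite /first_even -natr1 addrK.
have {}n2 : 2 <= n%:R :> R by rewrite ler_nat.
rewrite mulr_gt0//; first by rewrite divr_gt0//; nra.
rewrite big_ltn// ltr_pwDl ?exprn_gt0 ?divr_gt0//; first lra.
by apply: sumr_ge0 => i _; rewrite exprn_ge0// divr_ge0.
Qed.

Lemma first_odd_gt0 n m : (2 <= n)%N -> 0 < first_odd n.+1 m :> R.
Proof.
move=> n2; rewrite /first_odd -natr1 addrK.
have {}n2 : 2 <= n%:R :> R by rewrite ler_nat.
rewrite ltr_wpDl//; last by rewrite divr_gt0// exprn_gt0//; lra.
rewrite mulr_ge0//; first nra.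
by apply: sumr_ge0 => i _; rewrite divr_ge0// exprn_ge0.
Qed.

(** For k = 1 and k = 2 the two prescribed coefficients are the only ones, and
    [poincare_hardy] and [poincare_rellich] give them directly. *)
Theorem radial_inequality n k : (0 < k)%N -> (4 * k - 2 <= n)%N ->
  exists D : nat -> R, [/\ forall i, (1 <= i <= k)%N -> 0 < D i,
    forall m, k = (2 * m)%N -> D k = lead_even n.+1 m /\ D 1%N = first_even n.+1 m,
    forall m, k = (2 * m + 1)%N -> D k = lead_odd n.+1 m /\ D 1%N = first_odd n.+1 m
    & improved_poincare n k D (radial_grad n k)].
Proof.
move=> k0 kn; case: (leqP k 2) => k2.
  have [k1|k1] : k = 1%N \/ k = 2%N by lia.
  - subst k; exists (fun=> 4^-1); split=> [//|m|m|f tf]; first lia.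
      move=> m1; have -> : m = 0%N by lia.
      rewrite lead_oddE /first_odd big_ord0 big_geq// mulr1 mulr0 add0r muln0.
      by split=> //; field.
    apply: dominated_lel (poincare_hardy _ tf) => [x x0|]; last lia.
    by rewrite /hardy_sum big_nat1 addrC expr1.
  subst k; have n6 : (6 <= n)%N by lia.
  exists (fun i => if i == 1%N then first_even n.+1 1 else lead_even n.+1 1).
  split=> [i _|m m1|m|f tf]; last 2 first.
  - lia.
  - apply: dominated_lel (poincare_rellich n6 tf) => x x0.
    rewrite /hardy_sum big_nat_recl// big_nat1/= lead_evenE big_ord0 mulr1.
    rewrite /first_even big_nat1 -natr1 addrK expr0 mulr1 addrC addrA.
    by rewrite le_eqVlt; apply/orP; left; apply/eqP; ring.
  - by case: ifP => _; [rewrite first_even_gt0//; lia|rewrite lead_even_gt0].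
  - by have -> : m = 1%N by lia.
have [[m km]|[m km]] :
    (exists m, k = 2 * m.+2)%N \/ (exists m, k = (2 * m.+1).+1)%N.
  by have := odd_double_half k; case: (odd k) => /= kE; [right; exists (k./2.-1)|
    left; exists (k./2.-2)]; lia.
- have [|F F0] := @even_profile n m; first lia.
  rewrite -km => H.
  have [|||D [D0 D1 Dk HD]] :=
    @spread_constants _ _ (first_even n.+1 m.+2) _ _ _ _ k2 _ _ F0 _ H.
  + by apply: first_even_gt0; lia.
  + by apply: first_even_lt; lia.
  + by apply: lead_even_gt0; lia.
  exists D; split=> // [m' km'|m'|f tf]; [|lia|].
    by rewrite D1 Dk; have -> : m' = m.+2 by lia.
  by rewrite /radial_grad km mul2n odd_double doubleK -mul2n -km; exact: HD.
- have [|F F0] := @odd_profile n m; first lia.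
  rewrite -km => H.
  have [|||D [D0 D1 Dk HD]] :=
    @spread_constants _ _ (first_odd n.+1 m.+1) _ _ _ _ k2 _ _ F0 _ H.
  + by apply: first_odd_gt0; lia.
  + by apply: first_odd_lt; lia.
  + by apply: lead_odd_gt0; lia.
  exists D; split=> // [m'|m' km'|f tf]; [lia| |].
    by rewrite D1 Dk; have -> : m' = m.+1 by lia.
  rewrite /radial_grad.
  have -> : odd k by rewrite km -addn1 oddD oddM.
  have -> : k./2 = m.+1 by rewrite km; lia.
  exact: HD.
Qed.

End radial_inequality.

(** * Derivatives along lines *)

Section lines.
Context {R : realType} {V : normedModType R}.
Implicit Types (g : V -> R) (a v : V) (t d : R).

Lemma derive_lineE g a v t :
  (derivable g (t *: v + a) v = derivable (fun s : R => g (s *: v + a)) t 1) *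
  ('D_v g (t *: v + a) = 'D_1 (fun s : R => g (s *: v + a)) t).
Proof.
rewrite /derivable /derive.
suff -> : (fun h : R => h^-1 *: ((g \o shift (t *: v + a)) (h *: v) - g (t *: v + a)))
  = (fun h : R => h^-1 *: (((fun s : R => g (s *: v + a)) \o shift t) (h *: 1)
      - g (t *: v + a))) by [].
apply/funext => h /=; congr (_ *: (g _ - _)).
by rewrite addrA -scalerDl /GRing.scale /= mulr1.
Qed.

Lemma is_derive_line g a v t d : is_derive (t *: v + a) v g d ->
  is_derive t 1 (fun s : R => g (s *: v + a)) d.
Proof. by case; rewrite !derive_lineE. Qed.

Lemma MVT_line g a v (c : R) :
  (forall t, `|t| <= `|c| -> derivable g (t *: v + a) v) ->
  exists2 t, `|t| <= `|c| & g (c *: v + a) - g a = c * 'D_v g (t *: v + a).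
Proof.
move=> dg.
pose phi (s : R) := g (s *: v + a).
have dphi (s : R) : s \in `[0, 1] -> is_derive s 1 (phi \o ( *%R c))
    (c * 'D_v g ((c * s) *: v + a)).
  rewrite in_itv /= => /andP[s0 s1].
  have cs : `|c * s| <= `|c| by rewrite normrM ler_piMr// ger0_norm.
  have H1 : is_derive (c * s) 1 phi ('D_v g ((c * s) *: v + a)).
    by apply: is_derive_line; exact/derivableP/dg.
  have H2 : is_derive s 1 ( *%R c) c.
    have H := is_derive1M (is_derive_cst c s (1 : R)) (is_derive_id s (1 : R)).
    by apply: (is_derive_eq H); rewrite mul0r add0r mulr1.
  by have := is_derive1_comp H1 H2; rewrite mulrC.
have dphi_oo (s : R) : s \in `]0, 1[ -> is_derive s 1 (phi \o ( *%R c))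
    (c * 'D_v g ((c * s) *: v + a)).
  by move=> s01; apply: dphi; exact: subset_itv_oo_cc s01.
have cphi : {within `[0, 1], continuous (phi \o ( *%R c))}.
  by apply: derivable_within_continuous => s /dphi[].
have [s s01] := MVT_segment ler01 dphi_oo cphi.
rewrite subr0 mulr1 /phi /= mulr1 mulr0 scale0r add0r => ->.
exists (c * s) => //; move: s01; rewrite in_itv /= => /andP[s0 s1].
by rewrite normrM ler_piMr// ger0_norm.
Qed.

End lines.

Section partial_derivatives.
Context {R : realType} {N : nat}.
Implicit Types (g : 'rV[R]_N -> R) (x v : 'rV[R]_N).

Lemma coord_le_norm x i : `|x 0 i| <= `|x|.
Proof.
rewrite [leRHS]/Num.norm /= mx_normrE; apply/bigmax_geP; right => /=.
by exists (0, i).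
Qed.

Lemma norm_le_coord x (e : R) : 0 <= e -> (forall i, `|x 0 i| <= e) -> `|x| <= e.
Proof.
move=> e0 H; rewrite [leLHS]/Num.norm /= mx_normrE; apply/bigmax_leP; split=> //.
by move=> [i j] _ /=; rewrite ord1.
Qed.

Let trunc v k : 'rV[R]_N := \row_j (if (j < k)%N then v 0 j else 0).

Let truncS v (k : 'I_N) : trunc v k.+1 = v 0 k *: delta_mx 0 k + trunc v k.
Proof.
apply/rowP => j; rewrite !mxE eqxx /= ltnS leq_eqVlt -val_eqE.
case: eqVneq => [/val_inj ->|_] /=; first by rewrite ltnn mulr1 addr0.
by rewrite mulr0 add0r.
Qed.

Let partial_quotient g x v (k : 'I_N) :
  (\forall y \near x, derivable g y (delta_mx 0 k)) ->
  {for x, continuous (fun y => 'D_(delta_mx 0 k) g y)} ->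
  h^-1 *: (g (h *: trunc v k.+1 + x) - g (h *: trunc v k + x)) @[h --> (0 : R)^']
    --> v 0 k * 'D_(delta_mx 0 k) g x.
Proof.
move=> /nbhs_ballP[d /= d0 dg] cg.
have /choice[xi Hxi] : forall h : R, exists xi, `|x - xi| <= `|h| * `|v| /\
    (h != 0 -> `|h| * `|v| < d ->
     h^-1 *: (g (h *: trunc v k.+1 + x) - g (h *: trunc v k + x)) =
     v 0 k * 'D_(delta_mx 0 k) g xi).
  move=> h; have [hd|/negP hd] := boolP ((h != 0) && (`|h| * `|v| < d)); last first.
    exists x; rewrite subrr normr0 mulr_ge0//; split=> // h0 hv.
    by case: hd; rewrite h0.
  have [h0 hv] := andP hd.
  (* Every point of the k-th segment is within |h| |v| of x. *)
  have near_x t : `|t| <= `|h * v 0 k| ->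
      `|x - (t *: delta_mx 0 k + (h *: trunc v k + x))| <= `|h| * `|v|.
    move=> th; rewrite addrA opprD addrCA subrr addr0 normrN.
    apply: norm_le_coord => [|i]; first exact: mulr_ge0.
    rewrite !mxE eqxx /=; case: eqVneq => [->|ik] /=.
      rewrite ltnn mulr0 addr0 mulr1 (le_trans th)// normrM.
      by rewrite ler_wpM2l// coord_le_norm.
    rewrite mulr0 add0r normrM ler_wpM2l//; case: ifP => _; first exact: coord_le_norm.
    by rewrite normr0.
  have [|t th E] := @MVT_line _ _ g (h *: trunc v k + x) (delta_mx 0 k) (h * v 0 k).
    move=> t th; apply: dg; rewrite mx_norm_ball /ball_ /=.
    exact: le_lt_trans (near_x _ th) hv.
  exists (t *: delta_mx 0 k + (h *: trunc v k + x)); split=> [|_ _]; first exact: near_x.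
  by rewrite truncS (scalerDr h) (scalerA h) -addrA E /GRing.scale /= !mulrA mulVf// mul1r.
have cxi : xi h @[h --> (0 : R)^'] --> x.
  apply/cvgrPdist_le => e e0; near=> h.
  have [/le_trans + _] := Hxi h; apply.
  rewrite (@le_trans _ _ (`|h| * (`|v| + 1)))// ?ler_wpM2l ?lerDl//.
  rewrite -ler_pdivlMr ?ltr_wpDl//.
  by near: h; apply: dnbhs0_le; rewrite divr_gt0// ltr_wpDl.
have : v 0 k * 'D_(delta_mx 0 k) g (xi h) @[h --> (0 : R)^'] -->
    v 0 k * 'D_(delta_mx 0 k) g x.
  by apply: cvgMl_tmp; exact: continuous_cvg cg cxi.
apply: cvg_trans; apply: near_eq_cvg; near=> h.
have [_ ->//] := Hxi h.
  by near: h; exact: nbhs_dnbhs_neq.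
rewrite (@le_lt_trans _ _ (`|h| * (`|v| + 1)))// ?ler_wpM2l ?lerDl//.
rewrite -ltr_pdivlMr ?ltr_wpDl//.
by near: h; apply: dnbhs0_lt; rewrite divr_gt0// ltr_wpDl.
Unshelve. all: by end_near. Qed.

(** Join x to x + h v by segments parallel to the axes. The mean value theorem on
    each of them expresses its contribution through one partial derivative at a
    point that tends to x with h. *)
Lemma is_derive_partials g x v :
  (forall i, \forall y \near x, derivable g y (delta_mx 0 i)) ->
  (forall i, {for x, continuous (fun y => 'D_(delta_mx 0 i) g y)}) ->
  is_derive x v g (\sum_(i < N) v 0 i * 'D_(delta_mx 0 i) g x).
Proof.
move=> dg cg.
suff H : h^-1 *: ((g \o shift x) (h *: v) - g x) @[h --> (0 : R)^'] -->
    \sum_(i < N) v 0 i * 'D_(delta_mx 0 i) g x.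
  by split; [exact: cvgP H|exact: cvg_lim H].
have -> : (fun h : R => h^-1 *: ((g \o shift x) (h *: v) - g x)) =
    (fun h => \sum_(k < N)
      h^-1 *: (g (h *: trunc v k.+1 + x) - g (h *: trunc v k + x))).
  apply/funext => h /=.
  rewrite -scaler_sumr -(big_mkord xpredT
    (fun k => g (h *: trunc v k.+1 + x) - g (h *: trunc v k + x))).
  rewrite (telescope_sumr (fun k => g (h *: trunc v k + x)))//.
  congr (_ *: (g _ - g _)); [congr (_ *: _ + _)|]; last first.
    by rewrite (_ : trunc v 0 = 0) ?scaler0 ?add0r//; apply/rowP => j; rewrite !mxE.
  by apply/rowP => j; rewrite !mxE ltn_ord.
apply: cvg_big => [|k _]; first exact: add_continuous.
exact: partial_quotient.
Qed.

End partial_derivatives.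

(** * Restriction to rays from the pole *)

Section rays.
Context {R : realType} {n : nat}.
Local Notation N := n.+1.
Implicit Types (u : 'rV[R]_N -> R) (x s : 'rV[R]_N) (r : R).

Definition ray u s r := u (r *: s).

Lemma enormZ r x : 0 <= r -> enorm (r *: x) = r * enorm x.
Proof.
move=> r0; rewrite /enorm.
under eq_bigr do rewrite mxE exprMn.
by rewrite -mulr_sumr sqrtrM ?sqr_ge0// sqrtr_sqr ger0_norm.
Qed.

Lemma enorm1_neq0 s : enorm s = 1 -> s != 0.
Proof.
apply: contra_eq_neq => ->; rewrite /enorm big1 ?sqrtr0 1?eq_sym ?oner_neq0//.
by move=> i _; rewrite mxE expr0n.
Qed.

Lemma Cpos_sum k (I : Type) (l : seq I) (F : I -> R -> R) :
  (forall i, Cpos k (F i)) -> Cpos k (fun r => \sum_(i <- l) F i r).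
Proof.
move=> kF; elim: l => [|i l IH].
  by apply: (@eq_Cpos _ _ (fun=> 0)) => [r _|]; [rewrite big_nil|exact: Cpos_cst].
apply: (@eq_Cpos _ _ (fun r => F i r + \sum_(j <- l) F j r)).
  by move=> r _; rewrite big_cons.
exact: CposD.
Qed.

Lemma open_punctured : open (@punctured R N).
Proof.
rewrite (_ : punctured = ~` [set 0]).
  rewrite openC; apply: accessible_closed_set1; apply: hausdorff_accessible.
  exact: norm_hausdorff.
by apply/seteqP; split=> x /= /eqP.
Qed.

(** Along the ray each partial derivative of u has as derivative a combination,
    with the coordinates of s as coefficients, of partial derivatives of the next
    order; hence the induction over all iterated partial derivatives at once. *)
Lemma ray_smooth u s : smooth_on (@punctured R N) u -> s != 0 -> smooth (ray u s).
Proof.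
move=> su s0 k; rewrite -[u]/(iter_partial [::] u); move: [::].
elim: k => // k IH l.
apply: (@Cpos_is_derive _ _ _ (fun r => \sum_(i < N)
    s 0 i * ray (iter_partial (i :: l) u) s r)).
  move=> r r0; have rs0 : r *: s != 0 by rewrite scaler_eq0 negb_or lt0r_neq0.
  have -> : ray (iter_partial l u) s = (fun t => iter_partial l u (t *: s + 0)).
    by apply/funext => t; rewrite addr0.
  apply: is_derive_line; rewrite addr0.
  apply: is_derive_partials => i; last by have [] := su (i :: l) _ rs0.
  near=> y; have /(su l)[_] : y != 0; last by apply.
  near: y; apply: open_nbhs_nbhs; split; [exact: open_punctured|exact: rs0].
apply: Cpos_sum => i; apply: CposM; [exact: Cpos_cst|exact: IH].
Unshelve. all: by end_near. Qed.

Lemma Cc_infty_shell u : Cc_infty_punctured u ->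
  exists e M, 0 < e /\ forall x, (`|x| < e) || (M < `|x|) -> u x = 0.
Proof.
move=> [_ cu pu].
have [M [_ Mu]] := compact_bounded cu.
have : nbhs (0 : 'rV[R]_N) (~` closure [set x | u x != 0]).
  apply: open_nbhs_nbhs; split; first by rewrite openC; exact: closed_closure.
  by move=> /pu; rewrite /punctured /= eqxx.
move=> /nbhs_ballP[e /= e0 eu]; exists e, (M + 1); split=> // x.
move=> xeM; apply/eqP/negPn/negP => ux.
have cx : closure [set x | u x != 0] x by exact: subset_closure.
case/orP: xeM => [xe|]; last first.
  by apply/negP; rewrite -leNgt; apply: Mu cx; rewrite ltrDl.
by apply: (eu x) cx; rewrite mx_norm_ball /ball_ /= sub0r normrN.
Qed.

Lemma ray_test u s : Cc_infty_punctured u -> s != 0 -> test (ray u s).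
Proof.
move=> cu s0; have [su _ _] := cu; split; first exact: ray_smooth.
have [e [M [e0 eM]]] := Cc_infty_shell cu.
have sp : 0 < `|s| by rewrite normr_gt0.
exists (e / `|s|), (M / `|s|); split=> [|r r0 rab]; first exact: divr_gt0.
apply: eM; rewrite normrZ gtr0_norm//.
by move: rab; rewrite ltr_pdivlMr// ltr_pdivrMr.
Qed.

Lemma radial_derive_ray u s r : enorm s = 1 -> 0 < r ->
  radial_derive u (r *: s) = derive1 (ray u s) r.
Proof.
move=> s1 r0; rewrite /radial_derive /angle enormZ ?ltW// s1 mulr1 scalerA.
rewrite mulVf ?lt0r_neq0// scale1r derive1E -[in LHS](addr0 (r *: s)).
rewrite derive_lineE; congr ('D_1 _ r).
by apply/funext => t; rewrite addr0.
Qed.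

Lemma eq_radial_op k (f g : R -> R) : (forall x : R, 0 < x -> f x = g x) ->
  forall x : R, 0 < x -> radial_op k f x = radial_op k g x.
Proof.
move=> fg x x0; have fg1 := eq_pos_derive1 fg.
by rewrite /radial_op (eq_pos_derive1 fg1)// fg1.
Qed.

Lemma radial_laplacian_ray u s r : enorm s = 1 -> 0 < r ->
  radial_laplacian u (r *: s) = radial_op n (ray u s) r.
Proof.
move=> s1 r0; rewrite /radial_laplacian /radial_op !radial_derive_ray//.
rewrite (enormZ _ (ltW r0)) s1 mulr1 -natr1 addrK.
rewrite (@eq_pos_derive1 _ (ray (radial_derive u) s) (derive1 (ray u s))) => [//|t t0|//].
exact: radial_derive_ray.
Qed.

Lemma iter_radial_laplacian_ray m u s r : enorm s = 1 -> 0 < r ->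
  iter m radial_laplacian u (r *: s) = iter m (radial_op n) (ray u s) r.
Proof.
move=> s1; elim: m r => // m IH r r0.
by rewrite !iterS radial_laplacian_ray//; exact: eq_radial_op.
Qed.

Lemma radial_grad_sq_ray k u s r : enorm s = 1 -> 0 < r ->
  radial_grad_sq k u (r *: s) = radial_grad n k (ray u s) r ^+ 2.
Proof.
move=> s1 r0; rewrite /radial_grad_sq /radial_grad; congr (_ ^+ 2).
case: (odd k); last exact: iter_radial_laplacian_ray.
rewrite radial_derive_ray//; apply: eq_pos_derive1 r0 => t t0.
exact: iter_radial_laplacian_ray.
Qed.

End rays.

(** * Integration over the half-line *)

Section half_line_integrals.
Context {R : realType}.
Implicit Types (f F G : R -> R) (a b x : R).
Local Notation mu := (@lebesgue_measure R).

Lemma smooth_continuous f x : smooth f -> 0 < x -> {for x, continuous f}.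
Proof.
move=> sf x0; apply: differentiable_continuous; apply/derivable1_diffP.
exact: smooth_C1.
Qed.

Lemma smooth_within_continuous f a b : smooth f -> 0 < a ->
  {within `[a, b], continuous f}.
Proof.
move=> sf a0; apply: derivable_within_continuous => x; rewrite in_itv /= => /andP[ax _].
by apply: smooth_C1 => //; exact: lt_le_trans ax.
Qed.

Lemma smooth_measurable f : smooth f -> measurable_fun (`]0, +oo[%classic : set R) f.
Proof.
move=> sf; apply: open_continuous_measurable_fun; first exact: interval_open.
by move=> x; rewrite inE /= in_itv /= andbT; exact: smooth_continuous.
Qed.

Lemma supported_integral F a b : 0 < a ->
  (forall x, 0 < x -> (x < a) || (b < x) -> F x = 0) ->
  (\int[mu]_(x in `]0%R, +oo[) (F x)%:E = \int[mu]_(x in `[a, b]) (F x)%:E)%E.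
Proof.
move=> a0 Fab; rewrite integral_mkcond [RHS]integral_mkcond.
congr (integral _ _ _); apply/funext => x; rewrite /patch !mem_setE !in_itv /= andbT.
case: ifPn => x0; case: ifPn => // xab.
  by rewrite Fab// !ltNge -negb_and.
by move: x0; rewrite (lt_le_trans a0)//; case/andP: xab.
Qed.

Lemma dominated_integral F G : test F -> test G ->
  (forall x, 0 < x -> 0 <= F x) -> dominated F G ->
  (\int[mu]_(x in `]0%R, +oo[) (F x)%:E
    <= \int[mu]_(x in `]0%R, +oo[) (G x)%:E)%E.
Proof.
move=> [sF [a1 [b1 [a10 HF]]]] [sG [a2 [b2 [a20 HG]]]] F0.
move=> [P [sP [a3 [b3 [a30 HP]]]] FGP].
(* An interval that contains all the supports in its interior, so that Phi
   vanishes at both ends. *)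
pose a := Num.min a1 (Num.min a2 a3) / 2.
pose b := Num.max a (Num.max b1 (Num.max b2 b3)) + 1.
have m0 : 0 < Num.min a1 (Num.min a2 a3) by rewrite !lt_min a10 a20.
have a0 : 0 < a by rewrite divr_gt0.
have am : a < Num.min a1 (Num.min a2 a3) by rewrite /a; lra.
have bM : Num.max a (Num.max b1 (Num.max b2 b3)) < b by rewrite /b; lra.
move: am bM; rewrite !lt_min !gt_max.
move=> /and3P[am1 am2 am3] /and4P[ab bm1 bm2 bm3].
have widen (c d x : R) : a < c -> d < b -> (x < a) || (b < x) -> (x < c) || (d < x).
  by move=> ac db /orP[xa|bx]; [rewrite (lt_trans xa)|rewrite (lt_trans db) ?orbT].
rewrite !(@supported_integral _ a b)//; last 2 first.
- by move=> x x0 xab; apply: HG => //; exact: widen xab.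
- by move=> x x0 xab; apply: HF => //; exact: widen xab.
have cF := smooth_within_continuous (b := b) sF a0.
have cG := smooth_within_continuous (b := b) sG a0.
have cP := smooth_within_continuous (b := b) sP a0.
have cP1 := smooth_within_continuous (b := b) (smooth_derive1 sP) a0.
have iG := continuous_compact_integrable (@segment_compact _ a b) cG.
have iP := continuous_compact_integrable (@segment_compact _ a b) cP1.
have mab : measurable (`[a, b]%classic : set R) by exact: measurable_itv.
apply: (@le_trans _ _ (\int[mu]_(x in `[a, b]) ((G x)%:E + (P^`() x)%:E))%E).
  apply: ge0_le_integral => //.
  - move=> x; rewrite /= in_itv /= => /andP[ax _].
    by rewrite lee_fin F0//; exact: lt_le_trans ax.
  - have iF := continuous_compact_integrable (@segment_compact _ a b) cF.
    by have /integrableP[] := iF.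
  - by apply: emeasurable_funD; [have /integrableP[] := iG|have /integrableP[] := iP].
  - move=> x; rewrite /= in_itv /= => /andP[ax _].
    by rewrite -EFinD lee_fin FGP//; exact: lt_le_trans ax.
rewrite integralD//.
have [Pa Pb] : P a = 0 /\ P b = 0.
  by split; apply: HP; rewrite ?am3 ?bm3 ?orbT//; exact: lt_trans ab.
have [_ La Rb] := (continuous_within_itvP _ ab).1 cP.
rewrite (@continuous_FTC2 _ P^`() P _ _ ab cP1)//; last first.
  split=> // x; rewrite in_itv /= => /andP[ax _].
  by apply: smooth_C1 => //; exact: lt_trans ax.
by rewrite Pa Pb subee// adde0.
Qed.

End half_line_integrals.

(** * Measurability in polar coordinates *)

Section measurability.
Context {R : realType} {n : nat}.
Local Notation N := n.+1.
Local Notation T := (R * N.-tuple R)%type.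
Implicit Types (F G : T -> R) (u : 'rV[R]_N -> R).

Lemma measurable_through_countable d (U : measurableType d) (C : countType)
    (q : U -> C) (h : C -> R) :
  (forall c, measurable (q @^-1` [set c])) -> measurable_fun setT (h \o q).
Proof.
move=> mq _ Y mY; rewrite setTI.
rewrite (_ : _ @^-1` _ = \bigcup_c (if h c \in Y then q @^-1` [set c] else set0)).
  apply: countable_bigcupT_measurable; first exact: countableP.
  by move=> c; case: ifP.
apply/seteqP; split=> [x /= xY|x [c _]].
  by exists (q x) => //; rewrite mem_set.
by case: ifPn => //= /set_mem hY ->.
Qed.

Let grid (k : nat) (t : N.-tuple R) : N.-tuple int :=
  [tuple Num.floor (k.+1%:R * tnth t i) | i < N].

Let measurable_grid k c : measurable (grid k @^-1` [set c]).
Proof.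
rewrite (_ : _ @^-1` _ = \bigcap_(i in [set: 'I_N])
    ((fun t : N.-tuple R => k.+1%:R * tnth t i) @^-1`
      `[(tnth c i)%:~R, (tnth c i + 1)%:~R[)).
  apply: fin_bigcap_measurable => // i _; rewrite -[X in measurable X]setTI.
  have mk : measurable_fun [set: N.-tuple R] (fun t => k.+1%:R * tnth t i).
    by apply: measurable_funM => //; exact: measurable_tnth.
  exact: mk.
apply/seteqP; split=> [t /= <- i _|t tc].
  by rewrite /= tnth_mktuple in_itv /= floor_itv.
apply: eq_from_tnth => i; rewrite tnth_mktuple.
by have := tc i I; rewrite /= in_itv /= => /floor_def.
Qed.

(** The sigma-algebra on tuples is generated by the coordinates. A continuous
    function is the limit of its values on the grids of mesh 1 / (k + 1), and each
    of these approximations factors through a countable type. *)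
Lemma measurable_continuous_row u : continuous u ->
  measurable_fun [set: N.-tuple R] (fun t => u (tuple_row t)).
Proof.
move=> cu; pose q k (c : N.-tuple int) : 'rV[R]_N :=
  \row_i ((tnth c i)%:~R / k.+1%:R).
apply: (@measurable_fun_cvg _ _ _ _ (fun k => (u \o q k) \o grid k)) => [k|t _].
  apply: measurable_through_countable => c; exact: measurable_grid.
apply: continuous_cvg; first exact: cu.
apply/cvgrPdist_le => e e0; near=> k.
have k0 : 0 < k.+1%:R^-1 :> R by rewrite invr_gt0.
apply: (@le_trans _ _ k.+1%:R^-1).
  apply: norm_le_coord => [|i]; first exact: ltW.
  rewrite !mxE tnth_mktuple; set y := tnth t i.
  have /andP[f1 f2] := floor_itv (k.+1%:R * y).
  rewrite -[y in y - _](@mulKf _ k.+1%:R)// [X in X - _]mulrC -mulrBl.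
  rewrite normrM (gtr0_norm k0) ler_piMl ?ltW//.
  by rewrite ger0_norm ?subr_ge0// ltrBlDl (lt_le_trans f2)// intrD.
by apply: ltW; near: k; exact: (near_infty_natSinv_lt (PosNum e0)).
Unshelve. all: by end_near. Qed.

Definition shell : set T := `]0%R, +oo[ `*` @unit_sphere R N.

Lemma measurable_unit_sphere : measurable (@unit_sphere R N).
Proof.
rewrite (_ : @unit_sphere R N = setT `&` (fun t : N.-tuple R => enorm (tuple_row t)) @^-1` [set 1]).
  exact: (measurable_enorm measurableT).
by rewrite setTI.
Qed.

Lemma measurable_shell : measurable shell.
Proof. by apply: measurableX; [exact: measurable_itv|exact: measurable_unit_sphere]. Qed.

Lemma measurable_ray u : continuous u ->
  measurable_fun shell (fun p : T => ray u (tuple_row p.2) p.1).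
Proof.
move=> cu; apply: (measurable_funS measurableT) => //.
pose m (p : T) : N.-tuple R := [tuple p.1 * tnth p.2 i | i < N].
rewrite (_ : (fun p : T => _) = (fun t => u (tuple_row t)) \o m).
  apply: measurableT_comp; first exact: measurable_continuous_row.
  apply/measurable_fun_tnthP => i.
  rewrite (_ : _ \o _ = (fun p : T => p.1 * tnth p.2 i)).
    apply: measurable_funM => //.
    exact: (measurableT_comp (measurable_tnth i) measurable_snd).
  by apply/funext => p /=; rewrite tnth_mktuple.
apply/funext => p; rewrite /ray /=; congr u.
by apply/rowP => i; rewrite !mxE tnth_mktuple.
Qed.

Lemma measurable_radius (f : R -> R) : smooth f ->
  measurable_fun shell (fun p => f p.1).
Proof.
move=> sf; apply: (@measurable_comp _ _ _ _ _ _ (`]0, +oo[%classic : set R) f shell fst).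
- exact: measurable_itv.
- by move=> _ [p [p0 _] <-].
- exact: smooth_measurable.
- exact: (measurable_funS measurableT).
Qed.

Definition radial_section (F : T -> R) (t : N.-tuple R) : R -> R := fun r => F (r, t).

Definition derive_radius F : T -> R := fun p => (radial_section F p.2)^`() p.1.

(** The derivative is the limit of the difference quotients with increments
    1 / (k + 1). *)
Lemma measurable_derive_radius F : measurable_fun shell F ->
  (forall p, shell p -> derivable (radial_section F p.2) p.1 1) ->
  measurable_fun shell (derive_radius F).
Proof.
move=> mF dF.
pose e k : R := k.+1%:R^-1.
pose h k (p : T) := (e k)^-1 * (F (p.1 + e k, p.2) - F p).
apply: (@measurable_fun_cvg _ _ _ _ h) => [k|p Dp].
  apply: measurable_funM => //; apply: measurable_funB => //.
  apply: (@measurable_comp _ _ _ _ _ _ shell F shell (fun p => (p.1 + e k, p.2))) => //.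
  - exact: measurable_shell.
  - move=> _ [p [p0 p1] <-]; split=> //=; move: p0; rewrite /= !in_itv /= !andbT => p0.
    by rewrite addr_gt0// invr_gt0.
  - apply: (measurable_funS measurableT) => //; apply: measurable_fun_pair => //.
    exact: measurable_funD.
have e_dnbhs : e k @[k --> \oo] --> (0 : R)^'.
  move=> A A0; have e0 : e k @[k --> \oo] --> (0 : R) by exact: cvg_harmonic.
  have {}e0 : \forall k \near \oo, e k != 0 -> A (e k) := e0 _ A0.
  by apply: filterS e0 => k; apply; rewrite /e invr_eq0 pnatr_eq0.
have hE : (fun k => h k p) =
    (fun x : R => x^-1 *: ((radial_section F p.2 \o shift p.1) (x *: 1)
      - radial_section F p.2 p.1)) \o e.
  apply/funext => k; rewrite /h /radial_section /= /GRing.scale /= mulr1.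
  by case: p {Dp} => r t /=; rewrite [r + _]addrC.
rewrite hE.
by rewrite /derive_radius derive1E; exact: cvg_comp e_dnbhs (dF p Dp).
Qed.

End measurability.

(** * Comparison of integrals ray by ray *)

Section polar_integrals.
Context {R : realType} {n : nat}.
Local Notation N := n.+1.
Local Notation T := (R * N.-tuple R)%type.
Local Notation shell := (@shell R n).
Local Notation mu := (lebesgue_measure \x @sphere_measure R N)%E.
Implicit Types (F G : T -> R) (u : 'rV[R]_N -> R).

(** Measurability is stable under radial derivatives only together with
    smoothness along each ray, so the two are carried at once. *)
Definition regular F := measurable_fun shell F /\
  forall s, unit_sphere s -> smooth (radial_section F s).

Lemma regularD F G : regular F -> regular G -> regular (fun p => F p + G p).
Proof.
move=> [mF sF] [mG sG]; split; first exact: measurable_funD.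
by move=> s Ss; apply: smoothD; [exact: sF|exact: sG].
Qed.

Lemma regularMl f F : smooth f -> regular F -> regular (fun p => f p.1 * F p).
Proof.
move=> sf [mF sF]; split; first by apply: measurable_funM => //; exact: measurable_radius.
by move=> s Ss; apply: smoothM => //; exact: sF.
Qed.

Lemma regular_sqr F : regular F -> regular (fun p => F p ^+ 2).
Proof.
move=> [mF sF]; split; first exact: measurable_funX.
by move=> s Ss; apply: smoothX; exact: sF.
Qed.

Lemma regular_derive_radius F : regular F -> regular (derive_radius F).
Proof.
move=> [mF sF]; split; last by move=> s Ss; exact/smooth_derive1/sF.
apply: measurable_derive_radius => // p [p0 Sp]; apply: smooth_C1; first exact: sF.
by move: p0; rewrite /= in_itv /= andbT.
Qed.

Lemma regular_iter_radial_op m F : regular F ->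
  regular (fun p => iter m (radial_op n) (radial_section F p.2) p.1).
Proof.
move=> rF; elim: m => [|m IH].
  by rewrite (_ : (fun p => _) = F)//; apply/funext => -[].
have rd := regular_derive_radius IH; have rdd := regular_derive_radius rd.
have sc : smooth (fun x : R => n%:R * coth x).
  by apply: smoothM; [exact: smooth_cst|exact: smooth_coth].
exact: (regularD rdd (regularMl sc rd)).
Qed.

Lemma regular_radial_grad k u : Cc_infty_punctured u -> continuous u ->
  regular (fun p => radial_grad n k (ray u (tuple_row p.2)) p.1).
Proof.
move=> cu contu.
have ru : regular (fun p : T => ray u (tuple_row p.2) p.1).
  split; first exact: measurable_ray.
  by move=> s Ss; have [] := ray_test cu (enorm1_neq0 Ss).
have ri := regular_iter_radial_op k./2 ru.
rewrite /radial_grad; case: (odd k) => //.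
exact: regular_derive_radius ri.
Qed.

Lemma Cc_infty_continuous u : Cc_infty_punctured u -> continuous u.
Proof.
move=> cu x; have [su _ _] := cu.
have [->|x0] := eqVneq x 0; last by have [] := su [::] x x0.
have [e [M [e0 eM]]] := Cc_infty_shell cu.
have u0 : u 0 = 0 by apply: eM; rewrite normr0 e0.
have near0 : \forall y \near (0 : 'rV[R]_N), u y = 0.
  by have := @nbhs0_lt R 'rV[R]_N e e0; apply: filterS => y ye; apply: eM; rewrite ye.
by rewrite /continuous_at u0; exact: cvg_near_cst near0.
Qed.

(** Tonelli's theorem, integrating first along the rays. *)
Lemma le_shell_integral F G : measurable_fun shell F -> measurable_fun shell G ->
  (forall p, shell p -> 0 <= F p) -> (forall p, shell p -> 0 <= G p) ->
  (forall s, unit_sphere s ->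
    (\int[lebesgue_measure]_(r in `]0%R, +oo[) (F (r, s))%:E
     <= \int[lebesgue_measure]_(r in `]0%R, +oo[) (G (r, s))%:E)%E) ->
  (\int[mu]_(p in shell) (F p)%:E <= \int[mu]_(p in shell) (G p)%:E)%E.
Proof.
move=> mF mG F0 G0 FG.
have mS := @measurable_shell R n.
have mE (H : T -> R) : measurable_fun shell H ->
    measurable_fun setT ((fun p => (H p)%:E) \_ shell).
  by move=> mH; apply/(measurable_restrictT _ mS)/measurable_EFinP.
have pE (H : T -> R) : (forall p, shell p -> 0 <= H p) ->
    forall p, (0 <= ((fun p => (H p)%:E) \_ shell) p)%E.
  by move=> H0 p; rewrite /patch; case: ifPn => // /set_mem /H0; rewrite lee_fin.
rewrite integral_mkcond [leRHS]integral_mkcond.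
rewrite !fubini_tonelli2; [|exact: mE|exact: pE|exact: mE|exact: pE].
apply: ge0_le_integral => //.
- by move=> s _; apply: integral_ge0 => r _; exact: pE.
- by apply: measurable_fun_fubini_tonelli_G; [exact: mE|exact: pE].
- by apply: measurable_fun_fubini_tonelli_G; [exact: mE|exact: pE].
move=> s _; rewrite /fubini_G.
have [Ss|Ss] := pselect (unit_sphere s); last first.
  rewrite !integral0_eq// => r _; rewrite patchE; case: ifPn => // /set_mem [] //.
have secE (H : T -> R) : (\int[lebesgue_measure]_r ((fun p => (H p)%:E) \_ shell) (r, s)
    = \int[lebesgue_measure]_(r in `]0%R, +oo[) (H (r, s))%:E)%E.
  rewrite [RHS]integral_mkcond; congr (integral _ _ _); apply/funext => r.
  rewrite /patch; congr (if _ then _ else _); apply/idP/idP => /set_mem.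
    by move=> [r0 _]; rewrite mem_set.
  by move=> r0; rewrite mem_set.
by rewrite !secE FG.
Qed.

End polar_integrals.

(** * Hyperbolic integrals *)

Section hyperbolic_integrals.
Context {R : realType} {n : nat}.
Local Notation N := n.+1.
Local Notation T := (R * N.-tuple R)%type.
Local Notation shell := (@shell R n).
Local Notation mu := (lebesgue_measure \x @sphere_measure R N)%E.
Implicit Types (F G : T -> R) (u : 'rV[R]_N -> R).

Lemma shell_gt0 p : shell p -> 0 < p.1.
Proof. by case; rewrite /= in_itv /= andbT. Qed.

Lemma hyp_integral_shell (f : 'rV[R]_N -> R) F :
  (forall p, shell p -> f (p.1 *: tuple_row p.2) * sinh p.1 ^+ n = F p) ->
  hyp_integral f = (\int[mu]_(p in shell) (F p)%:E)%E.
Proof.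
by move=> fF; apply: eq_integral => p /set_mem Dp; rewrite -fF.
Qed.

Lemma test_wsq k (f : R -> R) : test f -> test (wsq n k f).
Proof.
move=> tf; have [sf _] := tf.
rewrite (_ : wsq n k f = (fun x => f x * (x ^- k * f x * sinh x ^+ n))).
  apply: testM => //; apply: smoothM; last exact: smooth_weight.
  by apply: smoothM => //; exact: smooth_negpow.
by apply/funext => x; rewrite /wsq; ring.
Qed.

Lemma test_cstM (a : R) (f : R -> R) : test f -> test (fun x => a * f x).
Proof.
move=> tf; rewrite (_ : (fun x => _) = (fun x => f x * a)).
  by apply: testM => //; exact: smooth_cst.
by apply/funext => x; rewrite mulrC.
Qed.

Lemma test_hardy_sum k D (f : R -> R) : test f -> test (hardy_sum n k D f).
Proof.
move=> tf; rewrite /hardy_sum; elim: (index_iota _ _) => [|i l IH].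
  by rewrite (_ : (fun x => _) = (fun=> 0)); [exact: test0|apply/funext => x; rewrite big_nil].
rewrite (_ : (fun x => _) = (fun x => D i * wsq n (2 * i) f x
    + \sum_(j <- l) D j * wsq n (2 * j) f x)).
  by apply: testD => //; apply/test_cstM/test_wsq.
by apply/funext => x; rewrite big_cons.
Qed.

Lemma test_radial_grad k (f : R -> R) : test f -> test (radial_grad n k f).
Proof.
move=> tf; rewrite /radial_grad; case: (odd k); last exact: test_iter_radial_op.
exact/test_derive1/test_iter_radial_op.
Qed.

Lemma regular_wsq k (F : N.-tuple R -> R -> R) : regular (fun p : T => F p.2 p.1) ->
  measurable_fun shell (fun p => wsq n k (F p.2) p.1).
Proof.
move=> rF.
have sw : smooth (fun x : R => x ^- k * sinh x ^+ n).
  by apply: smoothM; [exact: smooth_negpow|exact: smooth_weight].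
have [+ _] := regularMl sw (regular_sqr rF).
by apply: eq_measurable_fun => p _; rewrite /wsq; ring.
Qed.

Lemma Cc_infty_bounded u : Cc_infty_punctured u ->
  exists C : R, forall x, `|u x| <= C.
Proof.
move=> cu; have contu := Cc_infty_continuous cu; have [_ ku _] := cu.
have : compact [set u x | x in closure [set x | u x != 0]].
  by apply: continuous_compact => //; exact: continuous_subspaceT.
move=> /compact_bounded[M [_ Mu]]; exists (Num.max 0 (M + 1)) => x.
have [->|ux] := eqVneq (u x) 0; first by rewrite normr0 le_max lexx.
rewrite le_max; apply/orP; right; apply: (Mu (M + 1)); first by rewrite ltrDl.
by exists x => //; exact: subset_closure.
Qed.

Lemma enorm_le_norm (x : 'rV[R]_N) : enorm x <= N%:R * `|x|.
Proof.
rewrite -[leRHS]ger0_norm ?mulr_ge0// -sqrtr_sqr ler_sqrt ?sqr_ge0//.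
apply: (@le_trans _ _ (\sum_(i < N) `|x| ^+ 2)).
  apply: ler_sum => i _; rewrite -[leLHS]real_normK ?num_real//.
  by rewrite lerXn2r ?nnegrE// coord_le_norm.
rewrite sumr_const card_ord exprMn -[leLHS]mulr_natl ler_wpM2r ?sqr_ge0//.
by rewrite expr2 ler_peMl// ler1n.
Qed.

Lemma ray_bounded_support u : Cc_infty_punctured u ->
  exists2 B : R, 0 < B & forall s r, enorm s = 1 -> B < r -> ray u s r = 0.
Proof.
move=> cu; have [e [M [e0 eM]]] := Cc_infty_shell cu.
exists (N%:R * `|M| + 1) => [|s r s1 Br]; first by rewrite ltr_wpDl// mulr_ge0.
apply: eM; apply/orP; right.
have r0 : 0 < r by apply: le_lt_trans Br; rewrite addr_ge0// mulr_ge0.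
have N0 : 0 < N%:R :> R by rewrite ltr0n.
rewrite normrZ gtr0_norm// -(ltr_pM2l N0) mulrCA.
apply: (@lt_le_trans _ _ r); last by apply: ler_peMr; [exact: ltW|rewrite -[leLHS]s1 enorm_le_norm].
by apply: le_lt_trans Br; rewrite ler_wpDr// ler_wpM2l// ler_norm.
Qed.

(** The integrand is bounded, and vanishes beyond some radius. This makes the
    subtraction in the statement a genuine one: the integral of the squared
    gradient may be left in the extended reals. *)
Lemma sqr_integral_fin_num u : Cc_infty_punctured u ->
  (\int[mu]_(p in shell) (wsq n 0 (ray u (tuple_row p.2)) p.1)%:E)%E \is a fin_num.
Proof.
move=> cu; have contu := Cc_infty_continuous cu.
have [C uC] := Cc_infty_bounded cu.
have C0 : 0 <= C by exact: le_trans (normr_ge0 _) (uC 0).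
have [B B0 uB] := ray_bounded_support cu.
have mS := @measurable_unit_sphere R n.
pose E : set T := `]0, B] `*` @unit_sphere R N.
have mE : measurable E by apply: measurableX => //; exact: measurable_itv.
have ES : E `<=` shell.
  by move=> p [+ Sp]; rewrite /= in_itv /= => /andP[p0 _]; split=> //=; rewrite in_itv /= p0.
have mW : measurable_fun shell (fun p => wsq n 0 (ray u (tuple_row p.2)) p.1).
  apply: (@regular_wsq 0 (fun t => ray u (tuple_row t))).
  exact: (@regular_radial_grad R n 0 u cu contu).
set f := (fun p => wsq n 0 (ray u (tuple_row p.2)) p.1) in mW *.
have f0 p : shell p -> 0 <= f p by move=> /shell_gt0; exact: wsq_ge0.
have -> : (\int[mu]_(p in shell) (f p)%:E = \int[mu]_(p in E) (f p)%:E)%E.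
  rewrite integral_mkcond [RHS]integral_mkcond; congr (integral _ _ _).
  apply/funext => p; rewrite /patch; case: ifPn => [/set_mem Dp|nDp]; case: ifPn => // Ep.
    have [p0 Sp] := Dp; move: p0; rewrite /= in_itv /= andbT => p0.
    rewrite /f /wsq uB ?expr0n ?mulr0 ?mul0r//.
    rewrite ltNge; apply: contra Ep => pB; rewrite mem_set//; split=> //=.
    by rewrite in_itv /= p0.
  by move: nDp; rewrite mem_set//; apply: ES; exact: set_mem.
rewrite ge0_fin_numE; last by apply: integral_ge0 => p /ES /f0; rewrite lee_fin.
apply: (@le_lt_trans _ _ (\int[mu]_(p in E) cst (C ^+ 2 * expR B ^+ n)%:E p)%E).
  apply: ge0_le_integral => //.
  - by move=> p /ES /f0; rewrite lee_fin.
  - by apply/measurable_EFinP; exact: (measurable_funS (@measurable_shell R n) ES mW).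
  move=> p [+ Sp]; rewrite /= in_itv /= => /andP[p0 pB]; rewrite lee_fin /f /wsq.
  rewrite expr0 invr1 mul1r; apply: ler_pM.
  - exact: sqr_ge0.
  - by rewrite exprn_ge0// ltW// sinh_gt0.
  - by rewrite -[leLHS]real_normK ?num_real// lerXn2r ?nnegrE ?C0 ?uC.
  rewrite lerXn2r ?nnegrE ?expR_ge0 ?(ltW (sinh_gt0 p0))// /sinh.
  have := expR_gt0 (- p.1); have : expR p.1 <= expR B by rewrite ler_expR.
  have := expR_gt0 p.1; lra.
have muE : mu E = (@lebesgue_measure R `]0%R, B]%classic
    * @sphere_measure R N (@unit_sphere R N))%E.
  by apply: product_measure1E => //; exact: measurable_itv.
rewrite integral_cst// [X in (_ * X < _)%E]muE lte_mul_pinfty// ?lee_fin.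
  by rewrite mulr_ge0 ?sqr_ge0 ?exprn_ge0 ?expR_ge0.
rewrite lte_mul_pinfty//.
  by rewrite [X in X \is a fin_num]lebesgue_measure_itv /= lte_fin B0.
by rewrite -ge0_fin_numE// fin_num_measure.
Qed.

End hyperbolic_integrals.

(** * The theorem *)

Section radial_to_space.
Context {R : realType} {n : nat}.
Local Notation N := n.+1.
Local Notation T := (R * N.-tuple R)%type.
Local Notation shell := (@shell R n).
Local Notation mu := (lebesgue_measure \x @sphere_measure R N)%E.
Implicit Types (u : 'rV[R]_N -> R) (D : nat -> R).

Lemma hyp_integral_improvement k D u : (forall i, (1 <= i <= k)%N -> 0 < D i) ->
  improved_poincare n k D (radial_grad n k) -> Cc_infty_punctured u ->
  (\sum_(1 <= i < k.+1)
      (D i)%:E * hyp_integral (fun x => u x ^+ 2 / enorm x ^+ (2 * i))%R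
   <= hyp_integral (radial_grad_sq k u)
      - (spectral_gap n ^+ k)%:E * hyp_integral (fun x => u x ^+ 2)%R)%E.
Proof.
move=> D0 HD cu; have contu := Cc_infty_continuous cu.
pose f (p : T) := ray u (tuple_row p.2).
have tf p : shell p -> test (f p).
  by move=> [_ Sp]; apply: ray_test cu _; exact: enorm1_neq0.
have rf : regular (fun p : T => f p p.1) by exact: (regular_radial_grad 0 cu contu).
have mW i : measurable_fun shell (fun p => wsq n (2 * i) (f p) p.1).
  exact: (@regular_wsq R n (2 * i) (fun t => ray u (tuple_row t)) rf).
have mG : measurable_fun shell (fun p => wsq n 0 (radial_grad n k (f p)) p.1).
  exact: (@regular_wsq R n 0 (fun t => radial_grad n k (ray u (tuple_row t)))
    (regular_radial_grad k cu contu)).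
have W0 i p : shell p -> 0 <= wsq n (2 * i) (f p) p.1.
  by move=> /shell_gt0; exact: wsq_ge0.
have WE i : hyp_integral (fun x => u x ^+ 2 / enorm x ^+ (2 * i)) =
    (\int[mu]_(p in shell) (wsq n (2 * i) (f p) p.1)%:E)%E.
  apply: hyp_integral_shell => p Dp; have p0 := shell_gt0 Dp; have [_ s1] := Dp.
  by rewrite (enormZ _ (ltW p0)) s1 mulr1 /wsq /f /ray [u _ ^+ 2 / _]mulrC.
have uE : hyp_integral (fun x => u x ^+ 2) =
    (\int[mu]_(p in shell) (wsq n 0 (f p) p.1)%:E)%E.
  by apply: hyp_integral_shell => p _; rewrite /wsq expr0 invr1 mul1r.
have gE : hyp_integral (radial_grad_sq k u) =
    (\int[mu]_(p in shell) (wsq n 0 (radial_grad n k (f p)) p.1)%:E)%E.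
  apply: hyp_integral_shell => p Dp; have p0 := shell_gt0 Dp; have [_ s1] := Dp.
  by rewrite radial_grad_sq_ray// /wsq expr0 invr1 mul1r.
have gap0 : 0 <= spectral_gap n ^+ k :> R by rewrite exprn_ge0// sqr_ge0.
have mS := @measurable_shell R n.
rewrite leeBrDr; last by rewrite fin_numM// uE sqr_integral_fin_num.
rewrite uE gE.
rewrite (eq_big_nat _ _ (F2 := fun i =>
    (\int[mu]_(p in shell) (`|D i| * wsq n (2 * i) (f p) p.1)%:E)%E)); last first.
  move=> i ik; rewrite WE gtr0_norm ?D0//.
  rewrite -ge0_integralZl_EFin//; last 3 first.
  - by move=> p Dp; rewrite lee_fin W0.
  - by apply/measurable_EFinP; exact: mW.
  - by apply: ltW; exact: D0.
rewrite -ge0_integralZl_EFin//; last 2 first.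
- by move=> p /(W0 0%N); rewrite lee_fin.
- by apply/measurable_EFinP; exact: (mW 0%N).
rewrite -ge0_integral_sum//; last 2 first.
- by move=> i; apply/measurable_EFinP; apply: measurable_funM => //; exact: mW.
- by move=> i p Dp; rewrite lee_fin mulr_ge0 ?W0.
rewrite -ge0_integralD//; last 4 first.
- by move=> p Dp; apply: sume_ge0 => i _; rewrite lee_fin mulr_ge0 ?W0.
- apply: emeasurable_sum => i; apply/measurable_EFinP; apply: measurable_funM => //; exact: mW.
- by move=> p Dp; rewrite -EFinM lee_fin mulr_ge0 ?(W0 0%N).
- by apply/measurable_EFinP; apply: measurable_funM => //; exact: (mW 0%N).
pose P p := hardy_sum n k D (f p) p.1 + spectral_gap n ^+ k * wsq n 0 (f p) p.1.
have PE p : shell p -> (P p = \sum_(1 <= i < k.+1) `|D i| * wsq n (2 * i) (f p) p.1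
    + spectral_gap n ^+ k * wsq n 0 (f p) p.1).
  by move=> _; congr (_ + _); apply: eq_big_nat => i ik; rewrite gtr0_norm ?D0.
apply: (@le_trans _ _ (\int[mu]_(p in shell) (P p)%:E)%E).
  rewrite le_eqVlt; apply/orP; left; apply/eqP; apply: eq_integral => p /set_mem Dp.
  by rewrite PE// EFinD -sumEFin EFinM.
have P0 p : shell p -> 0 <= P p.
  move=> Dp; rewrite PE// addr_ge0//; last by rewrite mulr_ge0 ?(W0 0%N).
  by apply: sumr_ge0 => i _; rewrite mulr_ge0 ?W0.
have mP : measurable_fun shell P.
  apply: measurable_funD; last by apply: measurable_funM => //; exact: (mW 0%N).
  by apply: measurable_sum => i; apply: measurable_funM => //; exact: mW.
apply: le_shell_integral => //.
  by move=> p /shell_gt0; exact: wsq_ge0.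
move=> s Ss; pose g := ray u (tuple_row s).
have tg : test g by apply: ray_test cu _; exact: enorm1_neq0.
apply: (@dominated_integral R
  (fun r => hardy_sum n k D g r + spectral_gap n ^+ k * wsq n 0 g r)
  (wsq n 0 (radial_grad n k g))); last exact: HD.
- by apply: testD; [exact: test_hardy_sum|exact/test_cstM/test_wsq].
- exact/test_wsq/test_radial_grad.
- by move=> r r0; apply: (P0 (r, s)); split=> //=; rewrite in_itv /= r0.
Qed.

End radial_to_space.

Theorem corollary4p1 (R : realType) (k N : nat)
    (k_gt0 : (0 < k)%N) (N_ge : (4 * k - 1 <= N)%N) :
  exists D : nat -> R,
    [/\ forall i : nat, (1 <= i <= k)%N -> 0 < D i,
        forall u : 'rV[R]_N -> R, Cc_infty_punctured u ->
          (\sum_(1 <= i < k.+1)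
              (D i)%:E * hyp_integral (fun x => u x ^+ 2 / enorm x ^+ (2 * i))%R
           <= hyp_integral (radial_grad_sq k u)
              - (((N%:R - 1) / 2) ^+ (2 * k))%:E
                * hyp_integral (fun x => u x ^+ 2)%R)%E,
        forall m : nat, k = (2 * m)%N ->
          D k = ((N%:R - 4) / 2 ^+ (2 * m)) ^+ 2
                * \prod_(1 <= j < m)
                    ((N%:R + 4 * j%:R) ^+ 2 * (N%:R - 4 * j%:R - 4) ^+ 2)
          /\
          D 1%N = (N%:R ^+ 2 - 1) / 16
                  * \sum_(1 <= j < m.+1)
                      ((N%:R - 1) / 2) ^+ (4 * m - 2 * j - 2)
      & forall m : nat, k = (2 * m + 1)%N ->
          D k = 1 / 2 ^+ (4 * m + 2)
                * \prod_(1 <= j < m.+1)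
                    ((N%:R + 4 * j%:R - 2) ^+ 2 * (N%:R - 4 * j%:R - 2) ^+ 2)
          /\
          D 1%N = (N%:R ^+ 2 - 1)
                  * (\sum_(1 <= j < m.+1)
                      (N%:R - 1) ^+ (2 * m + 2 * j - 2)
                        / 2 ^+ (2 * m + 2 * j + 2))
                  + (N%:R - 1) ^+ (2 * m) / 2 ^+ (2 * m + 2)].
Proof.
case: N N_ge => [|n] N_ge; first lia.
have [|D [D0 Deven Dodd HD]] := @radial_inequality R n k k_gt0; first lia.
exists D; split=> // u cu.
have := hyp_integral_improvement D0 HD cu.
by rewrite /spectral_gap -exprM -(natr1 n) addrK.
Qed.
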